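(* Consider the DoQF protocol over independent Rayleigh fading channels, with quantization squared-error distortion $\Delta^2(\rho)\doteq\rho^{\delta}$ and relay power $\phi(\rho)\doteq\rho^{1+(1-r/t_0)^+}$. For every multiplexing gain $r\in[0,1]$, its DMT $d^*_{\mathrm{DoQF}}(r)=\sup_{t_0,\delta}d(t_0,\delta,r)$ is given by $$d^*_{\mathrm{DoQF}}(r)=\begin{cases}2(1-r)^+ & r\le\frac14,\\[2pt] 2-\dfrac{r}{1-v^*(r)} & \frac14<r\le\frac{2(\sqrt5-1)}{9-\sqrt5},\\[4pt] 2-\dfrac{2}{3-\sqrt5}\,r & \frac{2(\sqrt5-1)}{9-\sqrt5}<r\le\frac{\sqrt5-1}{\sqrt5+1},\\[4pt] (2-r)(1-r) & r>\frac{\sqrt5-1}{\sqrt5+1},\end{cases}$$ where, for $\frac14<r\le\frac{2(\sqrt5-1)}{9-\sqrt5}$, $v^*(r)$ is the unique solution in $\left[\frac12,\frac{2}{\sqrt5+1}\right]$ of the equation $$2(1+r)v^3-(4+5r)v^2+2(1+4r)v-4r=0 .$$ Moreover, the optimal value of $t_0$ (argument of the supremum) that allows to achieve the DMT $d^*_{\mathrm{DoQF}}(r)$ is $$t^*_{0,\mathrm{DoQF}}(r)=\begin{cases}\frac12 & 0\le r\le\frac14,\\ v^*(r) & \frac14<r\le\frac{2(\sqrt5-1)}{9-\sqrt5},\\ \frac{2}{\sqrt5+1} & \frac{2(\sqrt5-1)}{9-\sqrt5}<r\le\frac{\sqrt5-1}{\sqrt5+1},\\ \frac1{2-r} & r>\frac{\sqrt5-1}{\sqrt5+1},\end{cases}$$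 and the optimal value of $\delta$ that allows to achieve it is $$\delta^*_{\mathrm{DoQF}}(r)=\begin{cases}0 & 0\le r\le\frac14,\\ 4\frac{r}{v^*(r)}+2(r+1)v^*(r)-2-5r & \frac14<r\le\frac{2(\sqrt5-1)}{9-\sqrt5},\\ \frac{r}{t^*_{0,\mathrm{DoQF}}(r)} & r>\frac{2(\sqrt5-1)}{9-\sqrt5}.\end{cases}$$ (At $r=1$ the value $t_0=1$ is understood as a limiting value.)
   Context: Notation. $f(\rho)\doteq\rho^{d}$ means $\lim_{\rho\to\infty}\frac{\log f(\rho)}{\log\rho}=d$; $(x)^+=\max(0,x)$; $\overline{\mathcal A}$ is the complement of an event $\mathcal A$; $t_1=1-t_0$. Channels. Node 0 is the source, node 1 the relay, node 2 the destination. $H_{01},H_{02},H_{12}$ are independent, $H_{ij}\sim\mathcal{CN}(0,\sigma_{ij}^2)$ with $\sigma_{ij}^2>0$, so that $G_{ij}=|H_{ij}|^2$ is exponential with mean $\sigma_{ij}^2$. The rate depends on the SNR $\rho$: $R=R(\rho)$ with $\lim_{\rho\to\infty}R(\rho)/\log\rho=r$, the multiplexing gain (i.e. $R(\rho)=r\log\rho$ to leading order). DoQF (Decode or Quantize and Forward) protocol with parameters $t_0\in(0,1)$ (relative duration of the relay listening slot), fixed positive power constants $\alpha_0,\alpha_1$, distortion $\Delta^2(\rho)$ and relay power $\phi(\rho)$. Define the events - $\mathcal{E}=\{t_0\log(1+\alpha_0\rho G_{01})>R(\rho)\}$ (the relay decodes the source message, and then transmits an independent Gaussian codeword for it with power $\alpha_1\rho$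 in slot 1); - $\mathcal{S}=\{\alpha_0\rho G_{01}+1>\Delta^2(\rho)\}$ (when the relay does not decode, it can quantize its received signal with distortion $\Delta^2(\rho)$, and then forwards the quantization index in slot 1 with power $\phi(\rho)$; if neither $\mathcal E$ nor $\mathcal S$ holds it stays silent); - $\mathcal{F}=\left\{t_1\log\left(1+\frac{\phi(\rho)G_{12}}{\alpha_0\rho G_{02}+1}\right)>Q(\rho)t_0\right\}$, with $Q(\rho)=\log\frac{K}{\Delta^2(\rho)}$, $K=e^{R(\rho)/t_0}$ (the destination recovers the quantized signal). With $\gamma(G_{01},\rho)=\frac{(1+\alpha_0\rho G_{01}-\Delta^2(\rho))^2}{(1+\alpha_0\rho G_{01})^2}$, the outage probability of the protocol is $P_o(\rho)=P_{o,1}+P_{o,2}+P_{o,3}+P_{o,4}$, where $$P_{o,1}=\Pr[t_0\log(1+\alpha_0\rho G_{02})+t_1\log(1+\alpha_0\rho G_{02}+\alpha_1\rho G_{12})\le R]\,(1-\Pr[\overline{\mathcal{E}}]),$$ $$P_{o,2}=\Pr\left[t_1\log(1+\alpha_0\rho G_{02})+t_0\log\left(1+\alpha_0\rho G_{02}+\frac{\gamma(G_{01},\rho)\alpha_0\rho G_{01}}{\gamma(G_{01},\rho)+\Delta^2(\rho)\sqrt{\gamma(G_{01},\rho)}}\right)\le R,\ \overline{\mathcal{E}},\mathcal{F},\mathcal{S}\right],$$ $$P_{o,3}=\Pr[t_0\log(1+\alpha_0\rho G_{02})\le R,\ \overline{\mathcal{E}},\overline{\mathcal{F}},\mathcal{S}],\qquad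 P_{o,4}=\Pr[\log(1+\alpha_0\rho G_{02})\le R,\ \overline{\mathcal{E}},\overline{\mathcal{S}}].$$ The choice $\phi(\rho)\doteq\rho^{1+(1-r/t_0)^+}$ meets with equality, in the exponential sense, the long-term power constraint $\alpha_0\rho+\alpha_1\rho t_1(1-\Pr[\overline{\mathcal E}])+\phi(\rho)t_1\Pr[\overline{\mathcal E},\mathcal S]\le\rho$. DMT. For fixed $t_0,\delta$ (which may depend on $r$ but not on the channels), with $\Delta^2(\rho)\doteq\rho^\delta$, $d(t_0,\delta,r)=-\lim_{\rho\to\infty}\frac{\log P_o(\rho)}{\log\rho}$. The final DMT is $d^*_{\mathrm{DoQF}}(r)=\sup_{t_0,\delta}d(t_0,\delta,r)$ over $t_0\in(0,1)$, $\delta\in\mathbb{R}$, and $t^*_{0,\mathrm{DoQF}}(r),\delta^*_{\mathrm{DoQF}}(r)$ denote the argument of this supremum.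
   Formalization: At r=0 the rate is also assumed to satisfy R≐ρ^0 (R=0 gives zero outage); for r>2/3, attainment at (t0*,δ* ) assumes K≤Δ²(ρ) for large ρ, as Δ²=K/2 would give exponent at most 4(1-r)²<(2-r)(1-r). *)

(* Defs.v *)
From HB Require Import structures.
From mathcomp Require Import all_boot all_order all_algebra.
From mathcomp Require Import all_classical all_reals all_analysis.

Set Implicit Arguments.
Unset Strict Implicit.
Unset Printing Implicit Defensive.

Import Order.TTheory GRing.Theory Num.Theory.
Import numFieldNormedType.Exports.

Local Open Scope classical_set_scope.
Local Open Scope ring_scope.

(* [f] has exponent [a], i.e. log f(x) / log x tends to [a]. As [ln] is 0 on
   nonpositive reals, eventual positivity must be required separately. *)
Definition expo_eq {R : realType} (f : R -> R) (a : R) : Prop :=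
  (\forall x \near +oo, 0 < f x) /\
  ln (f x) / ln x @[x --> +oo] --> a.

Definition pos_part {R : realType} (x : R) : R := Num.max 0 x.

Section channels.
Context {R : realType} {d : measure_display} {T : measurableType d}.
Variable P : probability T R.

(* A complex random variable is given by its real and imaginary parts.
   [CN v H]: [H] is circularly symmetric complex Gaussian with mean 0 and
   variance [v], so that both parts are independent of variance [v / 2];
   the second argument of [normal_prob] is the standard deviation. *)
Definition CN (v : R) (H : {RV P >-> (R * R)%type}) : Prop :=
  forall A : set (R * R)%type, measurable A ->
    distribution P H A =
    (normal_prob 0 (Num.sqrt (v / 2)) \x normal_prob 0 (Num.sqrt (v / 2)))%E A.

(* One of the sets may be [setT], so this contains pairwise independence. *)
Definition independent3 (X Y Z : {RV P >-> (R * R)%type}) : Prop :=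
  forall A B C : set (R * R)%type, measurable A -> measurable B -> measurable C ->
    P (X @^-1` A `&` Y @^-1` B `&` Z @^-1` C) =
    (P (X @^-1` A) * P (Y @^-1` B) * P (Z @^-1` C))%E.

Definition gain (H : {RV P >-> (R * R)%type}) (w : T) : R :=
  (H w).1 ^+ 2 + (H w).2 ^+ 2.

End channels.

Section outage.
Context {R : realType} {d : measure_display} {T : measurableType d}.
Variables (P : probability T R) (G01 G02 G12 : T -> R).
Variables (alpha0 alpha1 t0 : R).
(* [dist] is the squared-error distortion, the square of Delta. *)
Variables (rate dist phi : R -> R).

Let t1 : R := 1 - t0.

(* [decode], [can_quantize], [recover_quant], [code_size] and [quant_rate] are
   the events E, S, F and the quantities K and Q. *)
Definition decode (rho : R) : set T :=
  [set w | t0 * ln (1 + alpha0 * rho * G01 w) > rate rho].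

Definition can_quantize (rho : R) : set T :=
  [set w | alpha0 * rho * G01 w + 1 > dist rho].

Definition code_size (rho : R) : R := expR (rate rho / t0).

Definition quant_rate (rho : R) : R := ln (code_size rho / dist rho).

Definition recover_quant (rho : R) : set T :=
  [set w | t1 * ln (1 + phi rho * G12 w / (alpha0 * rho * G02 w + 1))
           > quant_rate rho * t0].

Definition gam (rho g : R) : R :=
  (1 + alpha0 * rho * g - dist rho) ^+ 2 / (1 + alpha0 * rho * g) ^+ 2.

Definition outage1 (rho : R) : \bar R :=
  (P [set w | t0 * ln (1 + alpha0 * rho * G02 w)
              + t1 * ln (1 + alpha0 * rho * G02 w + alpha1 * rho * G12 w)
              <= rate rho]%R
   * (1 - P (~` decode rho)))%E.

Definition outage2 (rho : R) : \bar R :=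
  P ([set w | t1 * ln (1 + alpha0 * rho * G02 w)
              + t0 * ln (1 + alpha0 * rho * G02 w
                         + gam rho (G01 w) * alpha0 * rho * G01 w
                           / (gam rho (G01 w)
                              + dist rho * Num.sqrt (gam rho (G01 w))))
              <= rate rho]
     `&` ~` decode rho `&` recover_quant rho `&` can_quantize rho).

Definition outage3 (rho : R) : \bar R :=
  P ([set w | t0 * ln (1 + alpha0 * rho * G02 w) <= rate rho]
     `&` ~` decode rho `&` ~` recover_quant rho `&` can_quantize rho).

Definition outage4 (rho : R) : \bar R :=
  P ([set w | ln (1 + alpha0 * rho * G02 w) <= rate rho]
     `&` ~` decode rho `&` ~` can_quantize rho).

Definition outage (rho : R) : \bar R :=
  (outage1 rho + outage2 rho + outage3 rho + outage4 rho)%E.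

(* Extended logarithm and limit: an outage probability decaying faster than
   every power of [rho] has exponent +oo. *)
Definition has_dmt (l : \bar R) : Prop :=
  (lne (outage rho) * ((ln rho)^-1)%:E)%E @[rho --> +oo%R] --> (- l)%E.

End outage.

Section optimum.
Context {R : realType}.
Implicit Types r v : R.

Let sqrt5 : R := Num.sqrt 5.

Definition golden : R := 2 / (sqrt5 + 1).

Definition r_low : R := 1 / 4.
Definition r_mid : R := 2 * (sqrt5 - 1) / (9 - sqrt5).
Definition r_high : R := (sqrt5 - 1) / (sqrt5 + 1).

Definition is_vstar r v : Prop :=
  1 / 2 <= v <= golden /\
  2 * (1 + r) * v ^+ 3 - (4 + 5 * r) * v ^+ 2 + 2 * (1 + 4 * r) * v - 4 * r = 0.

Definition vstar r : R := xget 0 [set v | is_vstar r v].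

Definition d_DoQF r : R :=
  if r <= r_low then 2 * pos_part (1 - r)
  else if r <= r_mid then 2 - r / (1 - vstar r)
  else if r <= r_high then 2 - 2 / (3 - sqrt5) * r
  else (2 - r) * (1 - r).

Definition t0_DoQF r : R :=
  if r <= r_low then 1 / 2
  else if r <= r_mid then vstar r
  else if r <= r_high then golden
  else 1 / (2 - r).

Definition delta_DoQF r : R :=
  if r <= r_low then 0
  else if r <= r_mid then 4 * (r / vstar r) + 2 * (r + 1) * vstar r - 2 - 5 * r
  else r / t0_DoQF r.

End optimum.

(* Main.v *)
Require Import Defs.
From HB Require Import structures.
From mathcomp Require Import all_boot all_order all_algebra.
From mathcomp Require Import all_classical all_reals all_analysis.
From mathcomp Require Import measurable_realfun ring lra.

(* Write the gains as [rho ^ (- U)], [rho ^ (- V)], [rho ^ (- W)].  As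
   P[G <= a] is of order [a] for small [a], a set of triples (U, V, W) has
   probability of exponent the minimum of U + V + W (over nonnegative triples),
   and after division by [ln rho] the outage events become piecewise linear
   conditions on U, V, W.

   Optimality: for each (t0, delta) one exhibits a triple in one of the four
   outage events whose cost U + V + W is at most the claimed value.
   Achievability: at the claimed (t0, delta) all triples of the four events
   cost at least that much.  For r < t0 the costs that matter are
   2 - r / t1 and (1 - r) / t0 (relay decodes), 2 - 2r - delta or 2 - r - r / t0
   (quantized signal recovered), 4 - 4r / t0 - (r - delta t0) / t1 (quantized
   signal lost), 2 - r - min(delta, r / t0) (silent relay); balancing the first
   three gives the cubic equation of v*, and r + delta reaches r / t0 at the
   golden ratio. *)

Set Implicit Arguments.
Unset Strict Implicit.
Unset Printing Implicit Defensive.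

Import Order.TTheory GRing.Theory Num.Theory.
Import numFieldNormedType.Exports.

Local Open Scope classical_set_scope.
Local Open Scope ring_scope.

(** * Rayleigh gains near zero *)

(** No exponent is computed for general parameters. A pair [(t0, delta)] enters the supremum through
    a limit [l] that it is assumed to have, so lower bounds on the outage probability suffice on one
    side, and only the optimal pair needs matching upper bounds. All estimates aim at an exponent
    [q] strictly beyond the target: the gap absorbs the Rayleigh constants, the power constants and
    the number of boxes. Two places resist the logarithmic scale. At [r = 0] the rate threshold
    vanishes in units of [ln rho], which leaves no room for strict inequalities. At the tie
    [delta = r / t0] the exponents do not tell whether the relay can quantize without decoding; if
    it can, losing its signal costs [4 - 4 r / t0], which for [t0 = 1 / (2 - r)] is [4 (1 - r)^2],
    and this is at least [(2 - r)(1 - r)] exactly when [r <= 2/3] (for [r < 1]). Beyond [2/3] one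
    uses [K <= Delta^2], under which the two conditions on the relay contradict each other. *)

Section normal_bounds.
Context {R : realType}.
Implicit Types s x a : R.

Lemma normal_prob_itv_le s x : s != 0 -> 0 <= x ->
  (normal_prob 0 s `[(- x)%R, x]%classic <= (2 * x * normal_peak s)%R%:E)%E.
Proof.
move=> s0 x0; rewrite /normal_prob.
apply: (@le_trans _ _ (\int[lebesgue_measure]_(y in `[(- x)%R, x]%classic)
    (normal_peak s)%:E)%E).
  apply: ge0_le_integral => //=.
  - by move=> y _; rewrite lee_fin normal_pdf_ge0.
  - by apply/measurable_EFinP; apply: measurable_funTS; exact: measurable_normal_pdf.
  - by move=> y _; rewrite lee_fin; exact: normal_pdf_ub.
rewrite integral_cst//= lebesgue_measure_itv/= lte_fin.
case: ifPn => _; last first.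
  by rewrite mule0 lee_fin !mulr_ge0 ?normal_peak_ge0.
by rewrite -EFinB -EFinM lee_fin mulrC opprK -mulr2n mulr_natl.
Qed.

(** As [x <= 1], the interval stays below 2, where the density is at least its value at 2. *)
Lemma normal_prob_itv_ge s x : s != 0 -> 0 <= x <= 1 ->
  ((x * normal_pdf 0 s 2)%R%:E <= normal_prob 0 s `[x, (2 * x)%R]%classic)%E.
Proof.
move=> s0 /andP[x0 x1]; rewrite /normal_prob.
apply: (@le_trans _ _ (\int[lebesgue_measure]_(y in `[x, (2 * x)%R]%classic)
    (normal_pdf 0 s 2)%:E)%E).
  rewrite integral_cst//= lebesgue_measure_itv/= lte_fin.
  case: ifPn => h; first by rewrite -EFinB -EFinM lee_fin mulrC; apply: ler_wpM2l; [exact: normal_pdf_ge0|lra].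
  by rewrite mule0 lee_fin mulr_le0_ge0// ?normal_pdf_ge0//; lra.
apply: ge0_le_integral => //=.
- by move=> y _; rewrite lee_fin normal_pdf_ge0.
- by apply/measurable_EFinP; apply: measurable_funTS; exact: measurable_normal_pdf.
- move=> y; rewrite in_itv/= => /andP[xy y2]; rewrite lee_fin !normal_pdfE//.
  apply: ler_wpM2l; first exact: normal_peak_ge0.
  rewrite /normal_fun ler_expR !subr0 !mulNr lerN2 ler_pM2r; last first.
    by rewrite invr_gt0 mulrn_wgt0// exprn_even_gt0.
  by rewrite ler_pXn2r ?nnegrE//; lra.
Qed.

End normal_bounds.

Section gains.
Context {R : realType} {d : measure_display} {T : measurableType d}.
Variable P : probability T R.
Implicit Types G : T -> R.

(* Up to constants, the law of an exponential variable near 0. *)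
Definition fading_gain G : Prop :=
  [/\ measurable_fun setT G, forall w, 0 <= G w,
      exists C, forall a, 0 <= a -> (P (G @^-1` `]-oo, a]) <= (C * a)%R%:E)%E &
      exists c, 0 < c /\ forall a, 0 < a <= 1 ->
        ((c * a)%R%:E <= P (G @^-1` `[(2 * a)%R, (8 * a)%R]))%E].

Definition independent_gains G01 G02 G12 : Prop :=
  forall A B C : set R, measurable A -> measurable B -> measurable C ->
    P (G01 @^-1` A `&` G02 @^-1` B `&` G12 @^-1` C) =
    (P (G01 @^-1` A) * P (G02 @^-1` B) * P (G12 @^-1` C))%E.

Lemma measurable_sqr_norm :
  measurable_fun setT (fun z : R * R => z.1 ^+ 2 + z.2 ^+ 2).
Proof.
by apply: measurable_funD; apply: measurable_funX;
  [exact: measurable_fst|exact: measurable_snd].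
Qed.

Lemma gain_preimage (H : {RV P >-> (R * R)%type}) (A : set R) :
  gain H @^-1` A = H @^-1` ((fun z : R * R => z.1 ^+ 2 + z.2 ^+ 2) @^-1` A).
Proof. by []. Qed.

Lemma measurable_sqr_norm_preimage (A : set R) : measurable A ->
  measurable ((fun z : R * R => z.1 ^+ 2 + z.2 ^+ 2) @^-1` A).
Proof. by move=> mA; rewrite -[X in measurable X]setTI; exact: measurable_sqr_norm. Qed.

Lemma independent3_gains (H01 H02 H12 : {RV P >-> (R * R)%type}) :
  independent3 H01 H02 H12 ->
  independent_gains (gain H01) (gain H02) (gain H12).
Proof.
move=> ind A B C mA mB mC; rewrite !gain_preimage.
by apply: ind; exact: measurable_sqr_norm_preimage.
Qed.

(** Discs are compared with squares, whose probability is a product of two normal probabilities of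
    order [sqrt a]. Only these orders of magnitude of the exponential law are kept. *)
Lemma CN_fading_gain (v : R) (H : {RV P >-> (R * R)%type}) :
  0 < v -> CN v H -> fading_gain (gain H).
Proof.
move=> v0 HCN; set s := Num.sqrt (v / 2).
have s0 : s != 0 by rewrite gt_eqF// sqrtr_gt0 divr_gt0.
have mH : measurable_fun setT H by [].
split.
- exact: (measurableT_comp measurable_sqr_norm mH).
- by move=> w; rewrite addr_ge0 ?sqr_ge0.
- exists ((2 * normal_peak s) ^+ 2) => a a0.
  have sa0 := sqrtr_ge0 a.
  set I := `[- Num.sqrt a, Num.sqrt a]%classic.
  have mI0 : measurable I by exact: measurable_itv.
  have mI : measurable (I `*` I) by exact: measurableX.
  have Peq := HCN _ mI.
  apply: (@le_trans _ _ (P (H @^-1` (I `*` I)))).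
    apply: le_measure; rewrite ?inE.
    + by rewrite gain_preimage -[X in measurable X]setTI; apply: mH => //; exact: measurable_sqr_norm_preimage.
    + by rewrite -[X in measurable X]setTI; exact: mH.
    + move=> w h; have {h} : gain H w \in `]-oo, a] by exact: h.
      rewrite in_itv/= /gain => h.
      suff E : forall x y : R, x ^+ 2 + y ^+ 2 <= a -> - Num.sqrt a <= x <= Num.sqrt a.
        by split; rewrite /I/= in_itv/=; [apply: (E _ (H w).2)|apply: (E _ (H w).1); rewrite addrC].
      move=> x y xy; rewrite -ler_norml -(ler_pXn2r (n := 2)) ?nnegrE//.
      by rewrite sqr_sqrtr// real_normK ?num_real//; have := sqr_ge0 y; lra.
  rewrite [leLHS]Peq product_measure1E//= -/s.
  have := normal_prob_itv_le s0 sa0; rewrite -/I => h.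
  apply: le_trans (lee_pmul _ _ h h) _; rewrite ?measure_ge0//.
  rewrite -EFinM lee_fin -[X in _ <= _ * X](sqr_sqrtr a0) -exprMn -expr2.
  by rewrite mulrAC.
- exists (normal_pdf 0 s 2 ^+ 2); split.
    by rewrite exprn_gt0// normal_pdfE// mulr_gt0 ?expR_gt0 ?normal_peak_gt0.
  move=> a /andP[a0 a1].
  have sa0 := sqrtr_ge0 a.
  have sa : Num.sqrt a ^+ 2 = a by rewrite sqr_sqrtr// ltW.
  (* Coordinates in this interval have squares in [[a, 4a]], whence the window [[2a, 8a]] of
     [fading_gain]. *)
  set I := `[Num.sqrt a, 2 * Num.sqrt a]%classic.
  have mI0 : measurable I by exact: measurable_itv.
  have mI : measurable (I `*` I) by exact: measurableX.
  apply: (@le_trans _ _ (P (H @^-1` (I `*` I)))); last first.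
    apply: le_measure; rewrite ?inE.
    + by rewrite -[X in measurable X]setTI; exact: mH.
    + by rewrite gain_preimage -[X in measurable X]setTI; apply: mH => //; apply: measurable_sqr_norm_preimage; exact: measurable_itv.
    + move=> w [] /=; rewrite /I/= !in_itv/= /gain => /andP[l1 u1] /andP[l2 u2].
      have E : forall x : R, Num.sqrt a <= x -> x <= 2 * Num.sqrt a -> a <= x ^+ 2 <= 4 * a.
        by move=> x lx ux; apply/andP; split; nra.
      have := E _ l1 u1; have := E _ l2 u2; lra.
  rewrite [leRHS](HCN _ mI) product_measure1E//= -/s.
  have /(normal_prob_itv_ge s0) : 0 <= Num.sqrt a <= 1.
    by rewrite sa0/= -(ler_pXn2r (n := 2)) ?nnegrE// sa expr1n.
  rewrite -/I => h.
  apply: le_trans _ (lee_pmul _ _ h h).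
  + by rewrite -EFinM lee_fin -expr2 exprMn sa mulrC.
  + by rewrite lee_fin mulr_ge0// normal_pdf_ge0.
  + by rewrite lee_fin mulr_ge0// normal_pdf_ge0.
Qed.

End gains.

Section eventually.
Context {R : realType}.
Implicit Types a c rho : R.

Lemma near_pinfty_gt c : \forall rho \near +oo, c < rho.
Proof. by apply: nbhs_pinfty_gt; rewrite num_real. Qed.

Lemma near_ln_ge c : \forall rho \near +oo, c <= ln rho.
Proof.
near=> rho.
have h : expR c < rho by near: rho; exact: near_pinfty_gt.
by rewrite -[c]expRK ler_ln ?ltW ?posrE ?expR_gt0//; apply: lt_trans h; exact: expR_gt0.
Unshelve. all: by end_near. Qed.

Lemma near_powR_ge a c : 0 < a -> \forall rho \near +oo, c <= rho `^ a.
Proof.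
move=> a0; near=> rho.
have r1 : 1 < rho by near: rho; exact: near_pinfty_gt.
have r0 : 0 < rho by lra.
have [c0|c0] := lerP c 0; first by apply: le_trans c0 _; exact: powR_ge0.
rewrite -ler_ln ?posrE// ?powR_gt0// ln_powR -ler_pdivrMl//.
by near: rho; exact: near_ln_ge.
Unshelve. all: by end_near. Qed.

End eventually.

(** * Probabilities of events described by the three exponents *)

Section joint_bounds.
Context {R : realType} {d : measure_display} {T : measurableType d}.
Variable P : probability T R.
Variables G01 G02 G12 : T -> R.
Hypotheses (f01 : fading_gain P G01) (f02 : fading_gain P G02)
  (f12 : fading_gain P G12) (ind : independent_gains P G01 G02 G12).
Implicit Types (rho g : R) (A : R -> set T).

(** The windows are two-sided because outage events also bound gains from below: [S] asks for a
    strong enough [G01], [F] for a strong enough [G12]. *)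
Definition gain_box (u v w rho : R) : set T :=
  G01 @^-1` `[2 * rho `^ (- u), 8 * rho `^ (- u)] `&`
  G02 @^-1` `[2 * rho `^ (- v), 8 * rho `^ (- v)] `&`
  G12 @^-1` `[2 * rho `^ (- w), 8 * rho `^ (- w)].

Lemma measurable_gain_preimage (G : T -> R) (A : set R) :
  fading_gain P G -> measurable A -> measurable (G @^-1` A).
Proof. by case=> mG _ _ _ mA; rewrite -[X in measurable X]setTI; exact: mG. Qed.

Lemma measurable_gain_box u v w rho : measurable (gain_box u v w rho).
Proof.
by apply: measurableI; [apply: measurableI|]; apply: measurable_gain_preimage => //;
  exact: measurable_itv.
Qed.

Lemma gain_box_prob_ge u v w q : 0 <= u -> 0 <= v -> 0 <= w -> u + v + w < q ->
  \forall rho \near +oo, ((rho `^ (- q))%:E <= P (gain_box u v w rho))%E.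
Proof.
move=> u0 v0 w0 uvwq.
have [_ _ _ [c1 [c10 h1]]] := f01.
have [_ _ _ [c2 [c20 h2]]] := f02.
have [_ _ _ [c3 [c30 h3]]] := f12.
near=> rho.
have r1 : 1 < rho by near: rho; exact: near_pinfty_gt.
have r0 : 0 < rho by lra.
have le1 : forall x, 0 <= x -> 0 < rho `^ (- x) <= 1.
  move=> x x0; rewrite powR_gt0//= -[leRHS](powRr0 rho).
  by apply: ler_powR; [exact: ltW|lra].
rewrite /gain_box ind; try exact: measurable_itv.
apply: (@le_trans _ _ ((c1 * rho `^ (- u)) * (c2 * rho `^ (- v)) * (c3 * rho `^ (- w)))%R%:E).
  rewrite lee_fin [leRHS](_ : _ = (c1 * c2 * c3) * rho `^ (- (u + v + w))); last first.
    by rewrite !opprD !powRD ?(gt_eqF r0) ?implybT//; ring.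
  (* The positive power [rho ^ (q - (u + v + w))] eventually exceeds [1 / (c1 c2 c3)]. *)
  rewrite (_ : - q = - (q - (u + v + w)) + - (u + v + w)); last by ring.
  rewrite powRD ?(gt_eqF r0) ?implybT// ler_wpM2r ?powR_ge0// powRN.
  have c0 : 0 < c1 * c2 * c3 by rewrite !mulr_gt0.
  rewrite -[leRHS]invrK lef_pV2 ?posrE ?invr_gt0 ?powR_gt0//.
  by near: rho; apply: near_powR_ge; lra.
rewrite !EFinM; apply: lee_pmul.
- by rewrite -EFinM lee_fin !mulr_ge0 ?powR_ge0 ?ltW.
- by rewrite lee_fin !mulr_ge0 ?powR_ge0 ?ltW.
- apply: lee_pmul.
  + by rewrite lee_fin !mulr_ge0 ?powR_ge0 ?ltW.
  + by rewrite lee_fin !mulr_ge0 ?powR_ge0 ?ltW.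
  + by apply: h1; exact: le1.
  + by apply: h2; exact: le1.
- by apply: h3; exact: le1.
Unshelve. all: by end_near. Qed.

Lemma prob_ge_of_gain_box A u v w q :
  0 <= u -> 0 <= v -> 0 <= w -> u + v + w < q ->
  (\forall rho \near +oo, measurable (A rho)) ->
  (\forall rho \near +oo, gain_box u v w rho `<=` A rho) ->
  \forall rho \near +oo, ((rho `^ (- q))%:E <= P (A rho))%E.
Proof.
move=> u0 v0 w0 uvwq mA sA; near=> rho.
apply: (@le_trans _ _ (P (gain_box u v w rho))).
  by near: rho; exact: gain_box_prob_ge.
apply: le_measure; rewrite ?inE.
- exact: measurable_gain_box.
- by near: rho.
- by near: rho.
Unshelve. all: by end_near. Qed.

(** Clipped at 0: a gain above 1 is charged nothing, its probability being bounded by 1. *)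
Definition exponent rho g : R := Num.max 0 (- ln g / ln rho).

(** Nested half-lines rather than slices, since a union bound only asks for a cover. Layer 0 is the
    whole line, so gains above 1 are covered. *)
Let layer (eta rho : R) (i : nat) : set R :=
  [set g | i == 0%N \/ g <= rho `^ (- (i%:R * eta))].

Let measurable_layer eta rho i : measurable (layer eta rho i).
Proof.
rewrite /layer; case: (eqVneq i 0%N) => [->|i0].
  rewrite (_ : [set _ | _] = setT)//; apply/seteqP; split => // g _; by left.
rewrite (_ : [set _ | _] = `]-oo, rho `^ (- (i%:R * eta))]%classic).
  exact: measurable_itv.
by apply/seteqP; split => g /=; rewrite in_itv/=; [case|right].
Qed.

Let layer_prob (G : T -> R) : fading_gain P G ->
  exists K, 1 <= K /\ forall eta rho i, 0 < rho ->
    (P (G @^-1` layer eta rho i) <= (K * rho `^ (- (i%:R * eta)))%R%:E)%E.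
Proof.
move=> fG; have [_ _ [C hC] _] := fG; exists (Num.max 1 C); split.
  by rewrite le_max lexx.
move=> eta rho i r0; case: (eqVneq i 0%N) => [->|i0].
  rewrite mul0r oppr0 powRr0 mulr1; apply: (@le_trans _ _ 1%E).
    by apply: probability_le1; apply: measurable_gain_preimage.
  by rewrite lee_fin le_max lexx.
rewrite /layer (_ : [set _ | _] = `]-oo, rho `^ (- (i%:R * eta))]%classic); last first.
  by apply/seteqP; split => g /=; rewrite in_itv/= (negbTE i0); [case|right].
apply: le_trans (hC _ (powR_ge0 _ _)) _; rewrite lee_fin ler_wpM2r ?powR_ge0//.
by rewrite le_max lexx orbT.
Qed.

(** The index is the integer part of [exponent rho g / eta], capped at [M]. The cap also receives
    [g = 0], where the default value [ln 0 = 0] would give the wrong exponent 0. *)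
Let layerP (eta rho g : R) (M : nat) : 0 < eta -> 1 < rho -> 0 <= g ->
  exists i : 'I_M.+1, layer eta rho i g /\
    (i = M :> nat \/ (0 < g /\ exponent rho g < i.+1%:R * eta)).
Proof.
move=> eta0 r1; rewrite le_eqVlt => /orP[/eqP <-|g0].
  by exists ord_max; split; [right; exact: powR_ge0|left].
have L0 : 0 < ln rho by exact: ln_gt0.
have e0 : 0 <= exponent rho g by rewrite le_max lexx.
set n := Num.truncn (exponent rho g / eta).
have /andP[nl nu] : n%:R <= exponent rho g / eta < n.+1%:R.
  by apply: truncn_itv; rewrite divr_ge0// ltW.
have lay : forall m, (m <= n)%N -> layer eta rho m g.
  move=> m mn; case: (eqVneq m 0%N) => [->|m0]; first by left.
  right; rewrite -ler_ln ?posrE ?powR_gt0//; last by lra.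
  rewrite ln_powR mulNr lerNr.
  have : m%:R * eta <= exponent rho g.
    by rewrite -ler_pdivlMr//; apply: le_trans nl; rewrite ler_nat.
  rewrite /exponent le_max => /orP[|]; last by rewrite ler_pdivlMr.
  have : 0 < m%:R * eta by rewrite mulr_gt0// ltr0n lt0n.
  by move=> ? ?; exfalso; lra.
have [nM|Mn] := leqP n M.
  have nM' : (n < M.+1)%N by [].
  exists (Ordinal nM'); split; first exact: lay.
  by right; split => //=; rewrite -ltr_pdivrMr.
by exists ord_max; split; [apply: lay; exact: ltnW|left].
Qed.

Let bigsetU_prob_le (I : Type) (s : seq I) (p : pred I) (F : I -> set T) (c : R) :
  0 <= c -> (forall i, measurable (F i)) ->
  (forall i, p i -> (P (F i) <= c%:E)%E) ->
  measurable (\big[setU/set0]_(i <- s | p i) F i) /\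
  (P (\big[setU/set0]_(i <- s | p i) F i) <= ((size s)%:R * c)%R%:E)%E.
Proof.
move=> c0 mF hF; elim: s => [|i s [mU IH]].
  by rewrite big_nil measure0 mul0r; split.
rewrite big_cons /=; case: ifPn => pi; last first.
  split => //; apply: le_trans IH _.
  by rewrite lee_fin ler_wpM2r// ler_nat.
split; first exact: measurableU.
apply: le_trans (measureU2 _ _ _) _ => //.
rewrite -natr1 mulrDl mul1r addrC EFinD; apply: leeD => //; exact: hF.
Qed.

(* Discretize the three exponents with step [eta]: the event is covered by
   boundedly many boxes, each of probability about [rho ^ (- delta)]. *)
Lemma prob_le_of_exponent A (delta q : R) : q < delta ->
  (\forall rho \near +oo, measurable (A rho)) ->
  (\forall rho \near +oo, forall w, A rho w ->
     0 < G01 w -> 0 < G02 w -> 0 < G12 w ->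
     delta <= exponent rho (G01 w) + exponent rho (G02 w) + exponent rho (G12 w)) ->
  \forall rho \near +oo, (P (A rho) <= (rho `^ (- q))%:E)%E.
Proof.
move=> qd mA hA.
have [K1 [K11 h1]] := layer_prob f01.
have [K2 [K21 h2]] := layer_prob f02.
have [K3 [K31 h3]] := layer_prob f12.
(* Rounding down three exponents loses at most [3 * eta], half of [delta - q]; the other half
   absorbs the constants and the number of boxes. *)
set eta := (delta - q) / 6.
have eta0 : 0 < eta by rewrite divr_gt0 ?subr_gt0.
set M := (Num.truncn (Num.max 0 delta / eta)).+1.
have Md : delta <= M%:R * eta.
  rewrite -ler_pdivrMr//; apply: (@le_trans _ _ (Num.max 0 delta / eta)).
    by rewrite ler_pM2r ?invr_gt0// le_max lexx orbT.
  by apply: ltW; exact: truncnS_gt.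
set I3 := ('I_M.+1 * 'I_M.+1 * 'I_M.+1)%type.
set tot := fun x : I3 => (x.1.1%:R + x.1.2%:R + x.2%:R) * eta.
set p := fun x : I3 => delta - 3 * eta <= tot x.
near=> rho.
have r1 : 1 < rho by near: rho; exact: near_pinfty_gt.
have r0 : 0 < rho by lra.
set F := fun x : I3 => G01 @^-1` layer eta rho x.1.1 `&`
  G02 @^-1` layer eta rho x.1.2 `&` G12 @^-1` layer eta rho x.2.
have mF x : measurable (F x).
  by apply: measurableI; [apply: measurableI|]; exact: measurable_gain_preimage.
set c := K1 * K2 * K3 * rho `^ (- (delta - 3 * eta)).
have c0 : 0 <= c by rewrite !mulr_ge0 ?powR_ge0//; lra.
have Fc x : p x -> (P (F x) <= c%:E)%E.
  move=> px; rewrite /F ind; try exact: measurable_layer.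
  apply: (@le_trans _ _ ((K1 * rho `^ (- (x.1.1%:R * eta))) *
    (K2 * rho `^ (- (x.1.2%:R * eta))) * (K3 * rho `^ (- (x.2%:R * eta))))%R%:E).
    rewrite !EFinM; apply: lee_pmul; rewrite ?mule_ge0 ?measure_ge0//; last exact: h3.
    by apply: lee_pmul; rewrite ?measure_ge0//; [exact: h1|exact: h2].
  rewrite lee_fin [leLHS](_ : _ = K1 * K2 * K3 * rho `^ (- tot x)); last first.
    by rewrite /tot !mulrDl !opprD !powRD ?(gt_eqF r0) ?implybT//; ring.
  apply: ler_wpM2l; first by rewrite !mulr_ge0//; lra.
  by apply: ler_powR; [exact: ltW|rewrite lerN2].
have [mU PU] := bigsetU_prob_le (index_enum I3) c0 mF Fc.
apply: (@le_trans _ _ (P (\big[setU/set0]_(x <- index_enum I3 | p x) F x))).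
  apply: le_measure; rewrite ?inE//; first by near: rho.
  move=> w Aw.
  have [_ g01 _ _] := f01; have [_ g02 _ _] := f02; have [_ g12 _ _] := f12.
  have [i [il ih]] := layerP M eta0 r1 (g01 w).
  have [j [jl jh]] := layerP M eta0 r1 (g02 w).
  have [k [kl kh]] := layerP M eta0 r1 (g12 w).
  rewrite -bigcup_seq_cond; exists (i, j, k) => //=.
  rewrite mem_index_enum /=.
  rewrite /p /tot /=.
  have pos : forall m : 'I_M.+1, 0 <= m%:R * eta by move=> m; rewrite mulr_ge0// ltW.
  have pi := pos i; have pj := pos j; have pk := pos k.
  rewrite !mulrDl.
  (* An index at the cap [M] alone brings the cost to [delta]. *)
  case: ih => [->|[gi ih]]; first lra.
  case: jh => [->|[gj jh]]; first lra.
  case: kh => [->|[gk kh]]; first lra.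
  have : delta <= exponent rho (G01 w) + exponent rho (G02 w) + exponent rho (G12 w).
    have : forall w, A rho w ->
      0 < G01 w -> 0 < G02 w -> 0 < G12 w ->
      delta <= exponent rho (G01 w) + exponent rho (G02 w) + exponent rho (G12 w).
      by near: rho.
    exact.
  move: ih jh kh; rewrite -!natr1 !mulrDl mul1r; lra.
apply: le_trans PU _; rewrite lee_fin /c.
rewrite mulrA -ler_pdivlMr ?powR_gt0// -powRB ?(gt_eqF r0) ?implybT//.
near: rho; apply: near_powR_ge; rewrite /eta; lra.
Unshelve. all: by end_near. Qed.

End joint_bounds.

(** * Decay exponents *)

Section decay_exponent.
Context {R : realType}.
Implicit Types (f : R -> \bar R) (q d : R) (l : \bar R).
Local Open Scope ereal_scope.

Lemma decay_exponent_le f q l :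
  lne (f rho) * ((ln rho)^-1)%:E @[rho --> +oo%R] --> - l ->
  (\forall rho \near +oo%R, (rho `^ (- q))%:E <= f rho) -> l <= q%:E.
Proof.
move=> fl fq; rewrite -leeN2; apply: cvge_ge fl; near=> rho.
have r1 : (1 < rho)%R by near: rho; exact: near_pinfty_gt.
have L0 : (0 < ln rho)%R by exact: ln_gt0.
have Li0 : (0 < (ln rho)^-1)%R by rewrite invr_gt0.
have : (rho `^ (- q))%:E <= f rho by near: rho.
have p0 : (0 < rho `^ (- q))%R by rewrite powR_gt0//; lra.
case: (f rho) => [x| |]//.
- rewrite lee_fin => h; have x0 : (0 < x)%R by exact: lt_le_trans h.
  rewrite lne_EFin// -EFinM lee_fin -/(_ / _)%R ler_pdivlMr// -ln_powR.
  by rewrite ler_ln ?posrE.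
- by move=> _; rewrite gt0_mulye ?lte_fin// leey.
Unshelve. all: by end_near. Qed.

Lemma decay_exponent_cvg f d :
  (forall q, (d < q)%R -> \forall rho \near +oo%R, (rho `^ (- q))%:E <= f rho) ->
  (forall q, (q < d)%R -> \forall rho \near +oo%R, f rho <= (rho `^ (- q))%:E) ->
  lne (f rho) * ((ln rho)^-1)%:E @[rho --> +oo%R] --> - d%:E.
Proof.
move=> lo up.
have key : forall e, (0 < e)%R -> \forall rho \near +oo%R,
    lne (f rho) * ((ln rho)^-1)%:E \is a fin_num /\
    (`|- d - fine (lne (f rho) * ((ln rho)^-1)%:E)| <= e)%R.
  move=> e e0; near=> rho.
  have r1 : (1 < rho)%R by near: rho; exact: near_pinfty_gt.
  have L0 : (0 < ln rho)%R by exact: ln_gt0.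
  have p0 : forall a, (0 < rho `^ a)%R by move=> a; rewrite powR_gt0//; lra.
  have : (rho `^ (- (d + e)))%:E <= f rho by near: rho; apply: lo; lra.
  have : f rho <= (rho `^ (- (d - e)))%:E by near: rho; apply: up; lra.
  case: (f rho) => [x| |]//.
  rewrite !lee_fin => ux lx; have x0 : (0 < x)%R by exact: lt_le_trans (p0 _) lx.
  rewrite lne_EFin// -EFinM; split => //=.
  move: ux lx; rewrite -(ler_ln _ _) ?posrE// ln_powR -ler_pdivrMr// => ux.
  rewrite -(ler_ln _ _) ?posrE// ln_powR -ler_pdivlMr// => lx.
  by rewrite ler_norml; apply/andP; split; lra.
rewrite -EFinN; apply/fine_cvgP; split.
  by have := key 1%R ltr01; apply: filterS => rho [].
by apply/cvgrPdist_le => e e0; have := key e e0; apply: filterS => rho [].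
Unshelve. all: by end_near. Qed.

End decay_exponent.

(** * Measurability of the outage events *)

Section measurability.
Context {R : realType} {d : measure_display} {T : measurableType d}.
Implicit Types f g : T -> R.

Lemma measurable_set_ler f g : measurable_fun setT f -> measurable_fun setT g ->
  measurable [set w | f w <= g w].
Proof.
move=> mf mg.
have : measurable (setT `&` (fun w => f w <= g w) @^-1` [set true]).
  exact: measurable_fun_ler.
by rewrite setTI.
Qed.

Lemma measurable_set_ltr f g : measurable_fun setT f -> measurable_fun setT g ->
  measurable [set w | f w < g w].
Proof.
move=> mf mg.
have : measurable (setT `&` (fun w => f w < g w) @^-1` [set true]).
  exact: measurable_fun_ltr.
by rewrite setTI.
Qed.

(** On nonnegative reals inversion is the power [-1]; both conventions give 0 at 0. *)
Lemma measurable_fun_inv_ge0 f : measurable_fun setT f -> (forall w, 0 <= f w) ->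
  measurable_fun setT (fun w => (f w)^-1).
Proof.
move=> mf f0; rewrite (_ : (fun _ => _) = (@powR R ^~ (-1)) \o f).
  by apply: measurableT_comp mf; exact: measurable_powR.
by apply/funext => w /=; rewrite powR_inv1.
Qed.

Lemma measurable_fun_sqrt_ge0 f : measurable_fun setT f -> (forall w, 0 <= f w) ->
  measurable_fun setT (fun w => Num.sqrt (f w)).
Proof.
move=> mf f0; rewrite (_ : (fun _ => _) = (@powR R ^~ (2^-1)) \o f).
  by apply: measurableT_comp mf; exact: measurable_powR.
by apply/funext => w /=; rewrite powR12_sqrt.
Qed.

Lemma measurable_fun_ln f : measurable_fun setT f ->
  measurable_fun setT (fun w => ln (f w)).
Proof. by move=> mf; apply: measurableT_comp mf. Qed.

Variables (G01 G02 G12 : T -> R) (alpha0 alpha1 t0 : R) (rate dist phi : R -> R).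
Hypotheses (mG01 : measurable_fun setT G01) (mG02 : measurable_fun setT G02)
  (mG12 : measurable_fun setT G12).
Hypotheses (G01_ge0 : forall w, 0 <= G01 w) (G02_ge0 : forall w, 0 <= G02 w).
Hypothesis alpha0_gt0 : 0 < alpha0.

Local Notation E := (Defs.decode G01 alpha0 t0 rate).
Local Notation S := (can_quantize G01 alpha0 dist).
Local Notation F := (recover_quant G02 G12 alpha0 t0 rate dist phi).

Let mcst (c : R) : measurable_fun setT (fun _ : T => c).
Proof. exact: measurable_cst. Qed.

Let mD f g : measurable_fun setT f -> measurable_fun setT g ->
  measurable_fun setT (fun w => f w + g w).
Proof. exact: measurable_funD. Qed.

Let mB f g : measurable_fun setT f -> measurable_fun setT g ->
  measurable_fun setT (fun w => f w - g w).
Proof. exact: measurable_funB. Qed.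

Let mM f g : measurable_fun setT f -> measurable_fun setT g ->
  measurable_fun setT (fun w => f w * g w).
Proof. exact: measurable_funM. Qed.

Let mX f n : measurable_fun setT f -> measurable_fun setT (fun w => f w ^+ n).
Proof. exact: measurable_funX. Qed.

Ltac meas := repeat first [exact: mG01 | exact: mG02 | exact: mG12 |
  exact: mcst | apply: mX | apply: measurable_fun_ln | apply: mB | apply: mM | apply: mD].

Lemma measurable_decode rho : measurable (E rho).
Proof. by apply: measurable_set_ltr; meas. Qed.

Lemma measurable_can_quantize rho : measurable (S rho).
Proof. by apply: measurable_set_ltr; meas. Qed.

Lemma measurable_recover_quant rho : 0 < rho -> measurable (F rho).
Proof.
move=> r0; apply: measurable_set_ltr; meas.
apply: measurable_fun_inv_ge0; first by meas.
by move=> w; rewrite addr_ge0// !mulr_ge0// ltW.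
Qed.

Lemma measurable_outage1_event rho : measurable
  [set w | t0 * ln (1 + alpha0 * rho * G02 w)
    + (1 - t0) * ln (1 + alpha0 * rho * G02 w + alpha1 * rho * G12 w) <= rate rho].
Proof. by apply: measurable_set_ler; meas. Qed.

Lemma measurable_direct_event s rho :
  measurable [set w | s * ln (1 + alpha0 * rho * G02 w) <= rate rho].
Proof. by apply: measurable_set_ler; meas. Qed.

Lemma measurable_direct1_event rho :
  measurable [set w | ln (1 + alpha0 * rho * G02 w) <= rate rho].
Proof. by apply: measurable_set_ler; meas. Qed.

Lemma measurable_gam rho : measurable_fun setT (fun w => gam alpha0 dist rho (G01 w)).
Proof.
rewrite /gam; apply: mM; first by meas.
apply: measurable_fun_inv_ge0; first by meas.
by move=> w; exact: sqr_ge0.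
Qed.

Lemma gam_ge0 rho (g : R) : 0 <= gam alpha0 dist rho g.
Proof. by rewrite divr_ge0 ?sqr_ge0. Qed.

Lemma measurable_forward_event rho : 0 <= dist rho -> measurable
  [set w | (1 - t0) * ln (1 + alpha0 * rho * G02 w)
     + t0 * ln (1 + alpha0 * rho * G02 w
         + gam alpha0 dist rho (G01 w) * alpha0 * rho * G01 w
           / (gam alpha0 dist rho (G01 w)
              + dist rho * Num.sqrt (gam alpha0 dist rho (G01 w)))) <= rate rho].
Proof.
have mg := measurable_gam rho.
have msg := measurable_fun_sqrt_ge0 mg (fun w => gam_ge0 rho (G01 w)).
move=> d0; apply: measurable_set_ler; repeat first [exact: mg | exact: mG01
 | exact: mG02 | exact: mcst | apply: measurable_fun_ln | apply: mM | apply: mD].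
apply: measurable_fun_inv_ge0.
  by apply: mD => //; apply: mM => //; exact: mcst.
by move=> w; rewrite addr_ge0 ?gam_ge0// mulr_ge0 ?sqrtr_ge0.
Qed.

End measurability.

(** * Outage events on the logarithmic scale *)

Section log_add.
Context {R : realType}.
Implicit Types a b m : R.

Lemma ler_ln_le a b : 0 < a -> a <= b -> ln a <= ln b.
Proof. by move=> a0 ab; rewrite ler_ln ?posrE//; exact: lt_le_trans ab. Qed.

Lemma ln_add_le a b m : 0 < a -> 0 < b -> ln a <= m -> ln b <= m ->
  ln (a + b) <= m + ln 2.
Proof.
move=> a0 b0 am bm; rewrite -[m]expRK -lnM ?posrE ?expR_gt0//.
apply: ler_ln_le; first by rewrite addr_gt0.
have : a <= expR m by rewrite -[a]lnK ?posrE// ler_expR.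
have : b <= expR m by rewrite -[b]lnK ?posrE// ler_expR.
lra.
Qed.

(** In units of [L], [ln (Y + s)] is the maximum of [ln Y] and [ln s] up to [e]. The upper half is
    stated for every common bound [m], so that no maximum appears and linear arithmetic applies; [c]
    is the logarithm of a power constant. *)
Lemma ln_add_ratio (L e c n Y s : R) : 0 < L -> 0 < Y -> 0 < s ->
  ln s = c + L * n -> `|c| + ln 2 <= L * e ->
  (ln Y / L <= ln (Y + s) / L /\ n - e <= ln (Y + s) / L) /\
  (forall m, ln Y / L <= m -> n <= m -> ln (Y + s) / L <= m + e).
Proof.
move=> L0 Y0 s0 ls ce.
have ln2 : 0 <= ln (2 : R) by rewrite ln_ge0// ler1n.
have /andP[cl cu] : - `|c| <= c <= `|c| by rewrite -ler_norml.
split; first split.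
- by rewrite ler_pM2r ?invr_gt0//; apply: ler_ln_le => //; rewrite lerDl ltW.
- rewrite ler_pdivlMr// mulrC mulrBr.
  have : ln s <= ln (Y + s) by apply: ler_ln_le => //; rewrite lerDr ltW.
  rewrite ls; lra.
- move=> m; rewrite !ler_pdivrMr// => Ym nm.
  apply: (@le_trans _ _ (m * L + `|c| + ln 2)); last by rewrite mulrDl (mulrC e); lra.
  have c0 := normr_ge0 c.
  apply: ln_add_le => //; first by lra.
  have Ln : L * n <= m * L by rewrite mulrC ler_pM2r.
  by rewrite ls; lra.
Qed.

End log_add.

Section log_model.
Context {R : realType}.
Variables (alpha0 alpha1 t0 r delta psi : R) (rate dist phi : R -> R).
Hypotheses (alpha0_gt0 : 0 < alpha0) (alpha1_gt0 : 0 < alpha1).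
Hypothesis rate_r : rate rho / ln rho @[rho --> +oo] --> r.
Hypotheses (dist_expo : expo_eq dist delta) (phi_expo : expo_eq phi psi).
Implicit Types (rho e g u : R).

Definition forward_gain rho g : R :=
  gam alpha0 dist rho g * alpha0 * rho * g
  / (gam alpha0 dist rho g + dist rho * Num.sqrt (gam alpha0 dist rho g)).

(* All logarithms of the protocol, in units of [ln rho] and up to an error
   [e]: [x], [y] are those of the source-relay and source-destination SNRs,
   [y2], [f], [z] the ones occurring in [P_{o,1}], [F] and [P_{o,2}]. *)
Record log_model (rho e g01 g02 g12 x y y2 f z rr dd pp U V W : R) : Prop :=
  LogModel {
  lm_rr : r - e <= rr <= r + e;
  lm_dd : delta - e <= dd <= delta + e;
  lm_pp : psi - e <= pp <= psi + e;
  lm_U : U = - ln g01 / ln rho;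
  lm_V : V = - ln g02 / ln rho;
  lm_W : W = - ln g12 / ln rho;
  lm_E : (rate rho < t0 * ln (1 + alpha0 * rho * g01)) = (rr < t0 * x);
  lm_S : (dist rho < alpha0 * rho * g01 + 1) = (dd < x);
  lm_F : (quant_rate t0 rate dist rho * t0
          < (1 - t0) * ln (1 + phi rho * g12 / (alpha0 * rho * g02 + 1)))
         = ((rr / t0 - dd) * t0 < (1 - t0) * f);
  lm_O1 : (t0 * ln (1 + alpha0 * rho * g02)
           + (1 - t0) * ln (1 + alpha0 * rho * g02 + alpha1 * rho * g12)
           <= rate rho) = (t0 * y + (1 - t0) * y2 <= rr);
  lm_O2 : ((1 - t0) * ln (1 + alpha0 * rho * g02)
           + t0 * ln (1 + alpha0 * rho * g02 + forward_gain rho g01)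
           <= rate rho) = ((1 - t0) * y + t0 * z <= rr);
  lm_O3 : (t0 * ln (1 + alpha0 * rho * g02) <= rate rho) = (t0 * y <= rr);
  lm_O4 : (ln (1 + alpha0 * rho * g02) <= rate rho) = (y <= rr);
  lm_x : 0 <= x /\ 1 - U - e <= x;
  lm_x_le : forall m, 0 <= m -> 1 - U <= m -> x <= m + e;
  lm_y : 0 <= y /\ 1 - V - e <= y;
  lm_y_le : forall m, 0 <= m -> 1 - V <= m -> y <= m + e;
  lm_y2 : y <= y2 /\ 1 - W - e <= y2;
  lm_y2_le : forall m, y <= m -> 1 - W <= m -> y2 <= m + e;
  lm_f : 0 <= f /\ pp - W - y - e <= f;
  lm_f_le : forall m, 0 <= m -> pp - W - y <= m -> f <= m + e;
  lm_z : dd < x -> y <= z /\ (forall m, 0 <= m -> dd <= m -> x - m - e <= z);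
  lm_z_le : dd < x -> forall m, y <= m -> x - dd <= m -> z <= m + e }.

Lemma near_ratio (h : R -> R) (a e : R) : 0 < e ->
  h rho @[rho --> +oo] --> a -> \forall rho \near +oo, a - e <= h rho <= a + e.
Proof.
move=> e0 /cvgrPdist_le/(_ _ e0); apply: filterS => rho.
by rewrite ler_norml => /andP[? ?]; apply/andP; split; lra.
Qed.

(** Since [D < A], [sqrt gam = (A - D) / A], and the gain simplifies to
    [(A - D)(A - 1) / (A - D + D A)]. It may be tiny when [A] is close to [D]; the 1 added in the
    lower bound covers that case. *)
Lemma forward_gain_bounds rho g : 0 < rho -> 0 < g -> 0 < dist rho ->
  dist rho < alpha0 * rho * g + 1 ->
  let A := 1 + alpha0 * rho * g in
  [/\ 0 < forward_gain rho g, forward_gain rho g <= A / dist rho &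
      A / (4 * (1 + dist rho)) <= 1 + forward_gain rho g].
Proof.
move=> rho0 g0 D0 S A; set D := dist rho in D0 S *.
have s0 : 0 < alpha0 * rho * g by rewrite !mulr_gt0.
have A0 : 0 < A by rewrite /A; lra.
have AD : 0 < A - D by rewrite /A; lra.
set b := (A - D) / A.
have b0 : 0 < b by rewrite divr_gt0.
have gE : gam alpha0 dist rho g = b ^+ 2 by rewrite /gam /b expr_div_n.
have DA0 : 0 < A - D + D * A by rewrite addr_gt0// mulr_gt0.
have tE : forward_gain rho g = (A - D) * (A - 1) / (A - D + D * A).
  rewrite /forward_gain gE sqrtr_sqr gtr0_norm//.
  rewrite (_ : b ^+ 2 * alpha0 * rho * g = b ^+ 2 * (A - 1)); last by rewrite /A; ring.
  rewrite -/D /b; field; rewrite !gt_eqF//.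
  by rewrite addr_gt0// ?exprn_gt0// !mulr_gt0.
have A1 : 1 < A by rewrite /A; lra.
split.
- by rewrite tE divr_gt0// mulr_gt0//; lra.
- rewrite tE ler_pdivrMr// mulrAC ler_pdivlMr//.
  have : 0 <= A * (A - D) by rewrite mulr_ge0 ?ltW.
  have : 0 <= D * A by rewrite mulr_ge0 ?ltW.
  have : 0 <= D * (A - D) by rewrite mulr_ge0 ?ltW.
  have : 0 <= D * D * A by rewrite !mulr_ge0 ?ltW.
  nra.
- have D1 : 0 < 4 * (1 + D) by lra.
  have t0' : 0 <= forward_gain rho g by rewrite tE divr_ge0 ?mulr_ge0//; lra.
  rewrite ler_pdivrMr//.
  (* In the first case the left-hand side is at most 1; in the second, [A - D] and [A - 1] are both
     at least [A / 2]. *)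
  have [A2|A2] := lerP A (4 * (1 + D)); first by nra.
  apply: (@le_trans _ _ (forward_gain rho g * (4 * (1 + D)))); last by nra.
  rewrite tE -mulrA [X in _ * X]mulrC mulrA ler_pdivlMr//.
  have h1 : A / 2 <= A - D by lra.
  have h2 : A / 2 <= A - 1 by lra.
  have p1 : 0 <= D * A by rewrite mulr_ge0 ?ltW.
  have p2 : (A - D) * (1 + D) * (A / 2) <= (A - D) * (1 + D) * (A - 1).
    by apply: ler_wpM2l => //; apply: mulr_ge0; lra.
  have p3 : (A / 2) * (A * D) <= (A - D) * (A * D).
    by apply: ler_wpM2r => //; lra.
  have p4 : 0 <= A * (A - D) by apply: mulr_ge0; lra.
  nra.
Qed.

Let ln_error_bounds (L e : R) : `|ln alpha0| + `|ln alpha1| + ln 8 <= L * e ->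
  [/\ `|ln alpha0| + ln 2 <= L * e, `|ln alpha1| + ln 2 <= L * e,
      `|0 : R| + ln 2 <= L * e & ln 8 <= L * e].
Proof.
have a0 := normr_ge0 (ln alpha0); have a1 := normr_ge0 (ln alpha1).
have l8 : ln (2 : R) <= ln 8 by rewrite ler_ln ?posrE// ler_nat.
by move=> h; rewrite normr0; split; lra.
Qed.

(** The loss [ln 8] is [ln 4] from the factor in [forward_gain_bounds] plus [ln 2] from bounding
    [ln (1 + D)]. *)
Let forward_log_ge (L e A Y D t : R) : 0 < L -> 0 < A -> 0 < Y -> 1 < Y -> 0 < D -> 0 < t ->
  A / (4 * (1 + D)) <= 1 + t -> ln 8 <= L * e ->
  ln Y / L <= ln (Y + t) / L /\
  (forall m, 0 <= m -> ln D / L <= m -> ln A / L - m - e <= ln (Y + t) / L).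
Proof.
move=> L0 A0 Y0 Y1 D0 t0' lo le8; split.
  by rewrite ler_pM2r ?invr_gt0//; apply: ler_ln_le => //; rewrite lerDl ltW.
move=> m m0; rewrite ler_pdivrMr// => Dm.
have Lm : 0 <= m * L by rewrite mulr_ge0// ltW.
have D1 : 0 < 4 * (1 + D) by lra.
have : ln (A / (4 * (1 + D))) <= ln (Y + t).
  by apply: ler_ln_le; [rewrite divr_gt0|lra].
rewrite ln_div ?posrE// lnM ?posrE//; last by lra.
have : ln (1 + D) <= m * L + ln 2.
  by apply: ln_add_le => //; rewrite ln1.
have : ln (8 : R) = ln 4 + ln 2.
  by rewrite -lnM ?posrE// -natrM.
have E : (ln A / L - m - e) * L = ln A - m * L - L * e by field; rewrite gt_eqF.
by rewrite ler_pdivlMr// E; lra.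
Qed.

(** The threshold on [rho] precedes the gains: the errors depend only on [alpha0], [alpha1] and the
    limits for [rate], [dist], [phi]. This uniformity is what allows passing to probabilities. *)
Lemma near_log_model e : 0 < t0 -> 0 < e -> \forall rho \near +oo,
  forall g01 g02 g12, 0 < g01 -> 0 < g02 -> 0 < g12 ->
  exists x y y2 f z rr dd pp U V W,
    log_model rho e g01 g02 g12 x y y2 f z rr dd pp U V W.
Proof.
move=> t00 e0; have [dist0 dist_cvg] := dist_expo; have [phi0 phi_cvg] := phi_expo.
near=> rho.
have rho1 : 1 < rho by near: rho; exact: near_pinfty_gt.
have rho0 : 0 < rho by lra.
have L0 : 0 < ln rho by exact: ln_gt0.
have D0 : 0 < dist rho by near: rho.
have p0 : 0 < phi rho by near: rho.
have hr : r - e <= rate rho / ln rho <= r + e by near: rho; exact: near_ratio.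
have hd : delta - e <= ln (dist rho) / ln rho <= delta + e
  by near: rho; exact: (near_ratio e0 dist_cvg).
have hp : psi - e <= ln (phi rho) / ln rho <= psi + e
  by near: rho; exact: (near_ratio e0 phi_cvg).
have big : (`|ln alpha0| + `|ln alpha1| + ln 8) / e <= ln rho by near: rho; exact: near_ln_ge.
rewrite ler_pdivrMr// in big.
move=> g01 g02 g12 g010 g020 g120.
set L := ln rho in L0 hr hd hp big *.
have K0 : L != 0 by rewrite gt_eqF.
have snr : forall a g, 0 < a -> 0 < g -> ln (a * rho * g) = ln a + L * (1 - - ln g / L).
  move=> a g a0 gp; rewrite !lnM ?posrE ?mulr_gt0//.
  by rewrite -/L; field.
have sp : forall a g, 0 < a -> 0 < g -> 0 < a * rho * g.
  by move=> a g a0 gp; rewrite !mulr_gt0.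
have s01 := sp _ _ alpha0_gt0 g010.
have s02 := sp _ _ alpha0_gt0 g020.
have s12 := sp _ _ alpha1_gt0 g120.
have l01 := snr _ _ alpha0_gt0 g010.
have l02 := snr _ _ alpha0_gt0 g020.
have l12 := snr _ _ alpha1_gt0 g120.
set U := - ln g01 / L in l01. set V := - ln g02 / L in l02. set W := - ln g12 / L in l12.
set A := 1 + alpha0 * rho * g01. set Y := 1 + alpha0 * rho * g02.
have A0 : 0 < A by rewrite addr_gt0.
have Y0 : 0 < Y by rewrite addr_gt0.
have Ysym : alpha0 * rho * g02 + 1 = Y by rewrite addrC.
have Asym : alpha0 * rho * g01 + 1 = A by rewrite addrC.
have f0 : 0 < phi rho * g12 / Y by rewrite divr_gt0// mulr_gt0.
have lf : ln (phi rho * g12 / Y) = L * (ln (phi rho) / L - W - ln Y / L).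
  rewrite ln_div ?posrE ?mulr_gt0// lnM ?posrE// /W; by field.
have [ce0 ce1 ce ce8] := ln_error_bounds big.
have xP := ln_add_ratio L0 ltr01 s01 l01 ce0.
have yP := ln_add_ratio L0 ltr01 s02 l02 ce0.
have y2P := ln_add_ratio L0 Y0 s12 l12 ce1.
have fP := ln_add_ratio L0 ltr01 f0 (etrans lf (esym (add0r _))) ce.
rewrite ln1 mul0r -/A -/Y in xP yP fP.
have [xP1 xP2] := xP; have [yP1 yP2] := yP; have [y2P1 y2P2] := y2P; have [fP1 fP2] := fP.
have comb : forall a b c d q : R, (a * b + c * d <= q) = (a * (b / L) + c * (d / L) <= q / L).
  by move=> a b c d' q; rewrite !mulrA -mulrDl ler_pM2r// invr_gt0.
exists (ln A / L), (ln Y / L), (ln (Y + alpha1 * rho * g12) / L),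
  (ln (1 + phi rho * g12 / Y) / L), (ln (Y + forward_gain rho g01) / L),
  (rate rho / L), (ln (dist rho) / L), (ln (phi rho) / L), U, V, W.
have SE : (dist rho < A) = (ln (dist rho) / L < ln A / L).
  by rewrite ltr_pM2r ?invr_gt0// ltr_ln.
split => //.
- by rewrite mulrA ltr_pM2r// invr_gt0.
- by rewrite Asym.
- rewrite /quant_rate /code_size ln_div ?posrE ?expR_gt0// expRK Ysym.
  rewrite -(@ltr_pM2r _ L^-1) ?invr_gt0//.
  by congr (_ < _); field; rewrite ?K0 ?gt_eqF.
- by rewrite mulrA ler_pM2r// invr_gt0.
- by rewrite ler_pM2r// invr_gt0.
- rewrite -SE => S; have S' : dist rho < alpha0 * rho * g01 + 1 by rewrite Asym.
  have [t0' _ lo] := forward_gain_bounds rho0 g010 D0 S'.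
  apply: forward_log_ge => //; by rewrite /Y ltrDl.
- rewrite -SE => S m; have S' : dist rho < alpha0 * rho * g01 + 1 by rewrite Asym.
  have [t0' hi _] := forward_gain_bounds rho0 g010 D0 S'.
  rewrite -/A in hi => Ym xm.
  have AD : 0 < A / dist rho by rewrite divr_gt0.
  have lAD : ln (A / dist rho) = 0 + L * (ln A / L - ln (dist rho) / L).
    by rewrite ln_div ?posrE//; field.
  have [_ zP] := ln_add_ratio L0 Y0 AD lAD ce.
  apply: le_trans (zP m Ym xm); rewrite ler_pM2r ?invr_gt0//.
  by apply: ler_ln_le; [rewrite addr_gt0|rewrite lerD2l].
Unshelve. all: by end_near. Qed.

Lemma near_box_exponent u e : 0 < e -> \forall rho \near +oo,
  forall g, 2 * rho `^ (- u) <= g <= 8 * rho `^ (- u) ->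
  0 < g /\ u - e <= - ln g / ln rho <= u.
Proof.
move=> e0; near=> rho.
have rho1 : 1 < rho by near: rho; exact: near_pinfty_gt.
have L0 : 0 < ln rho by exact: ln_gt0.
have p0 : 0 < rho `^ (- u) by rewrite powR_gt0//; lra.
have big : ln 8 / e <= ln rho by near: rho; exact: near_ln_ge.
rewrite ler_pdivrMr// mulrC in big.
move=> g /andP[lg gu].
have g0 : 0 < g by lra.
have : ln (rho `^ (- u)) <= ln g by apply: ler_ln_le => //; lra.
have : ln g <= ln (8 * rho `^ (- u)) by apply: ler_ln_le.
rewrite lnM ?posrE// ln_powR => h1 h2; split => //.
by apply/andP; split; [rewrite ler_pdivlMr//|rewrite ler_pdivrMr//]; lra.
Unshelve. all: by end_near. Qed.

End log_model.

(** * Exponents of the four outage events *)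

Section outage_events.
Context {R : realType} {d : measure_display} {T : measurableType d}.
Variables (P : probability T R) (G01 G02 G12 : T -> R).
Hypotheses (f01 : fading_gain P G01) (f02 : fading_gain P G02)
  (f12 : fading_gain P G12) (ind : independent_gains P G01 G02 G12).
Variables (alpha0 alpha1 t0 r delta psi : R) (rate dist phi : R -> R).
Hypotheses (alpha0_gt0 : 0 < alpha0) (alpha1_gt0 : 0 < alpha1) (t01 : 0 < t0 < 1).
Hypothesis rate_r : rate rho / ln rho @[rho --> +oo] --> r.
Hypotheses (dist_expo : expo_eq dist delta) (phi_expo : expo_eq phi psi).
Implicit Types (rho e q u v w : R) (A : R -> set T) (l : \bar R).

Local Notation E := (Defs.decode G01 alpha0 t0 rate).
Local Notation S := (can_quantize G01 alpha0 dist).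
Local Notation F := (recover_quant G02 G12 alpha0 t0 rate dist phi).
Local Notation out := (outage P G01 G02 G12 alpha0 alpha1 t0 rate dist phi).
Local Notation out1 := (outage1 P G01 G02 G12 alpha0 alpha1 t0 rate).
Local Notation out2 := (outage2 P G01 G02 G12 alpha0 t0 rate dist phi).
Local Notation out3 := (outage3 P G01 G02 G12 alpha0 t0 rate dist phi).
Local Notation out4 := (outage4 P G01 G02 alpha0 t0 rate dist).
Local Notation model := (log_model alpha0 alpha1 t0 r delta psi rate dist phi).

Definition relayed_event rho : set T :=
  [set o | t0 * ln (1 + alpha0 * rho * G02 o)
    + (1 - t0) * ln (1 + alpha0 * rho * G02 o + alpha1 * rho * G12 o) <= rate rho].

Definition quantized_event rho : set T :=
  [set o | (1 - t0) * ln (1 + alpha0 * rho * G02 o)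
     + t0 * ln (1 + alpha0 * rho * G02 o + forward_gain alpha0 dist rho (G01 o))
     <= rate rho] `&` ~` E rho `&` F rho `&` S rho.

Definition unrecovered_event rho : set T :=
  [set o | t0 * ln (1 + alpha0 * rho * G02 o) <= rate rho]
  `&` ~` E rho `&` ~` F rho `&` S rho.

Definition silent_event rho : set T :=
  [set o | ln (1 + alpha0 * rho * G02 o) <= rate rho] `&` ~` E rho `&` ~` S rho.

Let mG01 : measurable_fun setT G01. Proof. by case: f01. Qed.
Let mG02 : measurable_fun setT G02. Proof. by case: f02. Qed.
Let mG12 : measurable_fun setT G12. Proof. by case: f12. Qed.
Let G01_ge0 : forall o, 0 <= G01 o. Proof. by case: f01. Qed.
Let G02_ge0 : forall o, 0 <= G02 o. Proof. by case: f02. Qed.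

Let mE rho : measurable (E rho). Proof. exact: measurable_decode. Qed.

Lemma measurable_relayed_event rho : measurable (relayed_event rho).
Proof. exact: measurable_outage1_event. Qed.

Lemma near_measurable_quantized_event :
  \forall rho \near +oo, measurable (quantized_event rho).
Proof.
have [dist0 _] := dist_expo; near=> rho.
have r0 : 0 < rho by near: rho; exact: near_pinfty_gt.
have D0 : 0 < dist rho by near: rho.
apply: measurableI; [apply: measurableI; [apply: measurableI|]|].
- exact: measurable_forward_event (ltW D0).
- exact: measurableC.
- exact: measurable_recover_quant.
- exact: measurable_can_quantize.
Unshelve. all: by end_near. Qed.

Lemma near_measurable_unrecovered_event :
  \forall rho \near +oo, measurable (unrecovered_event rho).
Proof.
near=> rho.
have r0 : 0 < rho by near: rho; exact: near_pinfty_gt.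
apply: measurableI; [apply: measurableI; [apply: measurableI|]|].
- exact: measurable_direct_event.
- exact: measurableC.
- by apply: measurableC; exact: measurable_recover_quant.
- exact: measurable_can_quantize.
Unshelve. all: by end_near. Qed.

Lemma measurable_silent_event rho : measurable (silent_event rho).
Proof.
apply: measurableI; [apply: measurableI|].
- exact: measurable_direct1_event.
- exact: measurableC.
- by apply: measurableC; exact: measurable_can_quantize.
Qed.

Local Open Scope ereal_scope.

Let out1E rho : out1 rho = P (relayed_event rho) * P (E rho).
Proof. by rewrite /outage1 -probability_setC ?setCK//; exact: measurableC. Qed.

Let out1_ge0 rho : 0 <= out1 rho.
Proof. by rewrite out1E mule_ge0 ?measure_ge0. Qed.

Lemma outage1_le rho : out1 rho <= out rho.
Proof.
by rewrite /outage -!addeA leeDl// !adde_ge0// /outage2/= /outage3 /outage4 measure_ge0.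
Qed.

Lemma outage2_le rho : P (quantized_event rho) <= out rho.
Proof.
rewrite /outage -addeA; apply: (@le_trans _ _ (out1 rho + out2 rho)).
  by rewrite leeDr.
by rewrite leeDl// adde_ge0// measure_ge0.
Qed.

Lemma outage3_le rho : P (unrecovered_event rho) <= out rho.
Proof.
rewrite /outage; apply: (@le_trans _ _ (out1 rho + out2 rho + out3 rho)).
  by rewrite leeDr// adde_ge0// measure_ge0.
by rewrite leeDl// measure_ge0.
Qed.

Lemma outage4_le rho : P (silent_event rho) <= out rho.
Proof. by rewrite /outage leeDr// !adde_ge0// measure_ge0. Qed.

(** On the box at [(u, v, w)] the model holds with any fixed [e], so a triple satisfying the strict
    linear conditions with margin forces the event. *)
Lemma event_prob_ge A u v w e :
  (0 < e)%R -> (0 <= u)%R -> (0 <= v)%R -> (0 <= w)%R ->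
  (\forall rho \near +oo%R, measurable (A rho)) ->
  (forall rho o x y y2 f z rr dd pp U V W,
     model rho e (G01 o) (G02 o) (G12 o) x y y2 f z rr dd pp U V W ->
     (u - e <= U <= u -> v - e <= V <= v -> w - e <= W <= w -> A rho o)%R) ->
  forall q, (u + v + w < q)%R ->
  \forall rho \near +oo%R, (rho `^ (- q))%:E <= P (A rho).
Proof.
move=> e0 u0 v0 w0 mA hA q uvwq.
apply: (prob_ge_of_gain_box f01 f02 f12 ind u0 v0 w0 uvwq mA).
have [t00 _] := andP t01.
near=> rho => o [[]].
have hu : (forall g : R, 2 * rho `^ (- u) <= g <= 8 * rho `^ (- u) ->
  0 < g /\ u - e <= - ln g / ln rho <= u)%R by near: rho; exact: near_box_exponent.
have hv : (forall g : R, 2 * rho `^ (- v) <= g <= 8 * rho `^ (- v) ->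
  0 < g /\ v - e <= - ln g / ln rho <= v)%R by near: rho; exact: near_box_exponent.
have hw : (forall g : R, 2 * rho `^ (- w) <= g <= 8 * rho `^ (- w) ->
  0 < g /\ w - e <= - ln g / ln rho <= w)%R by near: rho; exact: near_box_exponent.
have hm : (forall g01 g02 g12 : R, 0 < g01 -> 0 < g02 -> 0 < g12 ->
  exists x y y2 f z rr dd pp U V W,
    model rho e g01 g02 g12 x y y2 f z rr dd pp U V W)%R.
  by near: rho; exact: near_log_model.
rewrite /= !in_itv/= => /hu[g01 hU] /hv[g02 hV] /hw[g12 hW].
have [x [y [y2 [f [z [rr [dd [pp [U [V [W M]]]]]]]]]]] := hm _ _ _ g01 g02 g12.
apply: (hA rho o _ _ _ _ _ _ _ _ _ _ _ M).
- by rewrite (lm_U M).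
- by rewrite (lm_V M).
- by rewrite (lm_W M).
Unshelve. all: by end_near. Qed.

(** The cost bound may degrade linearly in the model error; [e] is then chosen so that the loss
    [C * e] is half of [b - q]. *)
Lemma event_prob_le A (b C : R) : (0 < C)%R ->
  (\forall rho \near +oo%R, measurable (A rho)) ->
  (forall rho o e x y y2 f z rr dd pp U V W, (0 < e)%R ->
     model rho e (G01 o) (G02 o) (G12 o) x y y2 f z rr dd pp U V W ->
     A rho o -> (b - C * e <= Num.max 0 U + Num.max 0 V + Num.max 0 W)%R) ->
  forall q, (q < b)%R -> \forall rho \near +oo%R, P (A rho) <= (rho `^ (- q))%:E.
Proof.
move=> C0 mA hA q qb; have [t00 _] := andP t01.
have e0 : (0 < (b - q) / (2 * C))%R by rewrite divr_gt0 ?subr_gt0// mulr_gt0.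
set e := ((b - q) / (2 * C))%R in e0.
have qe : (q < b - C * e)%R.
  have -> : (C * e = (b - q) / 2)%R by rewrite /e; field; rewrite gt_eqF.
  lra.
apply: (prob_le_of_exponent f01 f02 f12 ind qe mA).
near=> rho => o Ao g01 g02 g12.
have hm : (forall g01 g02 g12 : R, 0 < g01 -> 0 < g02 -> 0 < g12 ->
  exists x y y2 f z rr dd pp U V W,
    model rho e g01 g02 g12 x y y2 f z rr dd pp U V W)%R.
  by near: rho; exact: near_log_model.
have [x [y [y2 [f [z [rr [dd [pp [U [V [W M]]]]]]]]]]] := hm _ _ _ g01 g02 g12.
have := hA _ _ _ _ _ _ _ _ _ _ _ _ _ _ e0 M Ao.
by rewrite (lm_U M) (lm_V M) (lm_W M).
Unshelve. all: by end_near. Qed.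

Lemma outage_dmt_intro (b : R) :
  (forall q, (b < q)%R -> \forall rho \near +oo%R, (rho `^ (- q))%:E <= out rho) ->
  (forall q, (q < b)%R -> \forall rho \near +oo%R,
     P (relayed_event rho) <= (rho `^ (- q))%:E) ->
  (forall q, (q < b)%R -> \forall rho \near +oo%R,
     P (quantized_event rho) <= (rho `^ (- q))%:E) ->
  (forall q, (q < b)%R -> \forall rho \near +oo%R,
     P (unrecovered_event rho) <= (rho `^ (- q))%:E) ->
  (forall q, (q < b)%R -> \forall rho \near +oo%R,
     P (silent_event rho) <= (rho `^ (- q))%:E) ->
  has_dmt P G01 G02 G12 alpha0 alpha1 t0 rate dist phi b%:E.
Proof.
move=> lo h1 h2 h3 h4; apply: decay_exponent_cvg => // q qb.
(* The intermediate exponent absorbs the factor 4 from adding four probabilities. *)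
set q' := ((q + b) / 2)%R.
have q'b : (q' < b)%R by rewrite /q'; lra.
have qq' : (0 < q' - q)%R by rewrite /q'; lra.
near=> rho.
have rho1 : (1 < rho)%R by near: rho; exact: near_pinfty_gt.
have b1 : P (relayed_event rho) <= (rho `^ (- q'))%:E by near: rho; exact: h1.
have b2 : P (quantized_event rho) <= (rho `^ (- q'))%:E by near: rho; exact: h2.
have b3 : P (unrecovered_event rho) <= (rho `^ (- q'))%:E by near: rho; exact: h3.
have b4 : P (silent_event rho) <= (rho `^ (- q'))%:E by near: rho; exact: h4.
apply: (@le_trans _ _ (4 * rho `^ (- q'))%R%:E); last first.
  rewrite lee_fin (_ : - q = (q' - q) + (- q'))%R; last by ring.
  rewrite powRD; last by rewrite (gt_eqF (lt_trans ltr01 rho1)) implybT.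
  rewrite ler_wpM2r ?powR_ge0//; near: rho; exact: near_powR_ge.
rewrite (_ : (4 * rho `^ (- q') = rho `^ (- q') + rho `^ (- q') + rho `^ (- q') + rho `^ (- q'))%R); last by ring.
rewrite !EFinD /outage; apply: leeD => //; apply: leeD => //; apply: leeD => //.
rewrite out1E; apply: le_trans b1; rewrite -[leRHS]mule1.
by apply: lee_pmul; rewrite ?measure_ge0// probability_le1.
Unshelve. all: by end_near. Qed.

Local Close Scope ereal_scope.

Let small (a e : R) : 0 <= a <= 1 -> 0 < e -> 0 <= a * e <= e.
Proof. by move=> /andP[a0 a1] e0; apply/andP; split; nra. Qed.

(** For [r < t0], gains [G01] of order 1 already decode, so decoding has exponent 0. *)
Let near_decode_prob_ge q : r < t0 -> 0 < q ->
  \forall rho \near +oo, ((rho `^ (- q))%:E <= P (E rho))%E.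
Proof.
move=> rt q0; have [t00 t0lt] := andP t01.
have e0 : 0 < (t0 - r) / 3 by rewrite divr_gt0// subr_gt0.
apply: (event_prob_ge e0 (lexx 0) (lexx 0) (lexx 0)); last by rewrite !addr0.
  by near=> rho; exact: mE.
move=> rho o x y y2 f z rr dd pp U V W M hU _ _.
rewrite /Defs.decode /= (lm_E M).
have [_ hx] := lm_x M; have := lm_rr M; set e := (t0 - r) / 3 in e0 hU hx *.
have ee : t0 - r = 3 * e by rewrite /e; lra.
have /andP[_ te] : 0 <= t0 * e <= e by apply: small => //; lra.
have h : t0 * (1 - e) <= t0 * x by rewrite ler_pM2l//; lra.
lra.
Unshelve. all: by end_near. Qed.

(** [a] and [b] are upper bounds for the logarithms [y] and [y2]. The factor [P (E rho)] uses up
    only the part [q2] of the slack. *)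
Lemma outage_ge_relayed v w a b q : r < t0 -> 0 <= v -> 0 <= w ->
  0 <= a <= b -> 1 - v <= a -> 1 - w <= b -> t0 * a + (1 - t0) * b < r ->
  v + w < q -> \forall rho \near +oo, ((rho `^ (- q))%:E <= out rho)%E.
Proof.
move=> rt v0 w0 ab va wb hr vwq; have [t00 t0lt] := andP t01.
set q2 := (q - (v + w)) / 2.
have q20 : 0 < q2 by rewrite divr_gt0// subr_gt0.
set e := (r - (t0 * a + (1 - t0) * b)) / 4.
have e0 : 0 < e by rewrite divr_gt0// subr_gt0.
have ee : r - (t0 * a + (1 - t0) * b) = 4 * e by rewrite /e; lra.
have h : forall q, 0 + v + w < q ->
    \forall rho \near +oo, ((rho `^ (- q))%:E <= P (relayed_event rho))%E.
  apply: (event_prob_ge e0 (lexx 0) v0 w0).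
    by near=> rho; exact: measurable_relayed_event.
  move=> rho o x y y2 f z rr dd pp U V W M _ hV hW.
  rewrite /relayed_event /= (lm_O1 M).
  have hy : y <= a + e + e by apply: (lm_y_le M); lra.
  have hy2 : y2 <= b + 2 * e + e by apply: (lm_y2_le M); lra.
  have h1 : t0 * y <= t0 * (a + 2 * e) by rewrite ler_pM2l//; lra.
  have h2 : (1 - t0) * y2 <= (1 - t0) * (b + 3 * e) by rewrite ler_pM2l; lra.
  have /andP[te _] : 0 <= t0 * e <= e by apply: small => //; lra.
  have /andP[h3 _] := lm_rr M.
  lra.
near=> rho; have rho0 : 0 < rho by near: rho; exact: near_pinfty_gt.
apply: le_trans (outage1_le rho); rewrite out1E.
rewrite (_ : - q = - (q - q2) + - q2); last by ring.
rewrite powRD ?(gt_eqF rho0) ?implybT// EFinM.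
apply: lee_pmul; rewrite ?lee_fin ?powR_ge0//.
- by near: rho; apply: h; rewrite /q2; lra.
- by near: rho; exact: near_decode_prob_ge.
Unshelve. all: by end_near. Qed.

(* For [r = 0] the threshold on the logarithms is subpolynomial but not
   bounded below by a multiple of [ln rho]: use [ln (1 + s) <= s]. *)
Lemma outage_ge_relayed0 q : r = 0 -> expo_eq rate 0 -> 2 < q ->
  \forall rho \near +oo, ((rho `^ (- q))%:E <= out rho)%E.
Proof.
move=> r0 [rate_cvg0 rate_cvg] q2; have [t00 t0lt] := andP t01.
(* Gains of order [rho ^ (-1 - eta)] give SNRs of order [rho ^ (- eta)], below [rate rho], which is
   at least [rho ^ (- eta / 2)]. *)
set eta := (q - 2) / 4.
have eta0 : 0 < eta by rewrite divr_gt0// subr_gt0.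
have v0 : 0 <= 1 + eta by lra.
have h : \forall rho \near +oo,
    ((rho `^ (- (q - eta)))%:E <= P (relayed_event rho))%E.
  apply: (prob_ge_of_gain_box f01 f02 f12 ind (lexx 0) v0 v0).
  - by rewrite /eta; lra.
  - by near=> rho; exact: measurable_relayed_event.
  have eta2 : 0 < eta / 2 by rewrite divr_gt0.
  near=> rho => o [[_]] /=; rewrite !in_itv/= => /andP[V0 V1] /andP[W0 W1].
  have rho1 : 1 < rho by near: rho; exact: near_pinfty_gt.
  have L0 : 0 < ln rho by exact: ln_gt0.
  have rho0 : 0 < rho by lra.
  have hrate : 0 < rate rho by near: rho.
  have /andP[hl _] : 0 - eta / 2 <= ln (rate rho) / ln rho <= 0 + eta / 2.
    by near: rho; exact: near_ratio.
  have rge : rho `^ (- (eta / 2)) <= rate rho.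
    rewrite -ler_ln ?posrE ?powR_gt0// ln_powR -ler_pdivlMr//; lra.
  have big : 8 * (alpha0 + alpha1) <= rho `^ (eta / 2).
    by near: rho; exact: near_powR_ge.
  set p := rho `^ (- (1 + eta)) in V0 V1 W0 W1.
  have p0 : 0 < p by rewrite powR_gt0.
  have pE : rho * p = rho `^ (- (eta / 2)) * (rho `^ (eta / 2))^-1.
    rewrite -powRN -powRD ?(gt_eqF rho0) ?implybT// /p -[X in X * _](powRr1 (ltW rho0)).
    by rewrite -powRD ?(gt_eqF rho0) ?implybT//; congr (_ `^ _); lra.
  have key : (alpha0 + alpha1) * (8 * (rho * p)) <= rate rho.
    apply: le_trans rge; rewrite pE.
    rewrite [leLHS](_ : _ = 8 * (alpha0 + alpha1) / rho `^ (eta / 2)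
      * rho `^ (- (eta / 2))); last by ring.
    by rewrite ler_piMl ?powR_ge0// ler_pdivrMr ?powR_gt0// mul1r.
  have s0 : 0 < alpha0 * rho * G02 o by rewrite !mulr_gt0//; lra.
  have s1 : 0 < alpha1 * rho * G12 o by rewrite !mulr_gt0//; lra.
  have sb : alpha0 * rho * G02 o + alpha1 * rho * G12 o <= rate rho.
    apply: le_trans key; rewrite mulrDl; apply: lerD.
      by rewrite -mulrA ler_pM2l// mulrCA ler_pM2l.
    by rewrite -mulrA ler_pM2l// mulrCA ler_pM2l.
  have l1 : ln (1 + alpha0 * rho * G02 o) <= rate rho.
    by apply: le_trans (le_ln1Dx _) _; lra.
  have l2 : ln (1 + alpha0 * rho * G02 o + alpha1 * rho * G12 o) <= rate rho.
    by rewrite -addrA; apply: le_trans (le_ln1Dx _) _; lra.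
  rewrite /relayed_event /=.
  have m1 : t0 * ln (1 + alpha0 * rho * G02 o) <= t0 * rate rho by rewrite ler_pM2l.
  have m2 : (1 - t0) * ln (1 + alpha0 * rho * G02 o + alpha1 * rho * G12 o)
    <= (1 - t0) * rate rho by rewrite ler_pM2l// subr_gt0.
  lra.
near=> rho; have rho0 : 0 < rho by near: rho; exact: near_pinfty_gt.
apply: le_trans (outage1_le rho); rewrite out1E.
rewrite (_ : - q = - (q - eta) + - eta); last by ring.
rewrite powRD ?(gt_eqF rho0) ?implybT// EFinM.
apply: lee_pmul; rewrite ?lee_fin ?powR_ge0//.
- by near: rho.
- by near: rho; apply: near_decode_prob_ge => //; rewrite r0.
Unshelve. all: by end_near. Qed.

(** [G12] is taken of order 1. [b] and [c] bound [y] and [z] from above; [a] bounds from below the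
    relay-link logarithm of [F]. *)
Lemma outage_ge_quantized u v a b c q :
  0 <= u -> 0 <= v -> delta < 1 - u -> 0 <= 1 - u -> t0 * (1 - u) < r ->
  0 <= b -> 1 - v <= b -> b <= c -> 1 - u - delta <= c ->
  (1 - t0) * b + t0 * c < r -> r - delta * t0 < (1 - t0) * a -> a + b <= psi ->
  u + v < q -> \forall rho \near +oo, ((rho `^ (- q))%:E <= out rho)%E.
Proof.
move=> u0 v0 hS hu hE b0 hb bc uc hO hF ab uvq; have [t00 t0lt] := andP t01.
have [e [e0 eS eE eO eF]] : exists e, [/\ 0 < e, 3 * e < 1 - u - delta,
    4 * e <= r - t0 * (1 - u), 6 * e <= r - ((1 - t0) * b + t0 * c) &
    7 * e < (1 - t0) * a - (r - delta * t0)].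
  (* [m] is the smallest gap in the strict hypotheses; an eighth of it pays for all accumulated
     errors. *)
  set m := Num.min (Num.min (1 - u - delta) (r - t0 * (1 - u)))
    (Num.min (r - ((1 - t0) * b + t0 * c)) ((1 - t0) * a - (r - delta * t0))).
  have m0 : 0 < m by rewrite !lt_min !subr_gt0 hS hE hO hF.
  have : m <= m by []; rewrite {2}/m !le_min => /andP[/andP[? ?] /andP[? ?]].
  by exists (m / 8); split; lra.
near=> rho; apply: le_trans (outage2_le rho); near: rho.
move: uvq; rewrite -[u + v]addr0; apply: (event_prob_ge e0 u0 v0 (lexx 0)).
  exact: near_measurable_quantized_event.
move=> rho o x y y2 f z rr dd pp U V W M /andP[U1 U2] /andP[V1 V2] /andP[W1 W2].
have /andP[r1 r2] := lm_rr M; have /andP[d1 d2] := lm_dd M; have /andP[p1 p2] := lm_pp M.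
have [_ x1] := lm_x M; have [_ f1] := lm_f M.
have x2 : x <= (1 - u + e) + e by apply: (lm_x_le M); lra.
have y1 : y <= (b + e) + e by apply: (lm_y_le M); lra.
have dx : dd < x by lra.
have z1 : z <= (c + 4 * e) + e by apply: (lm_z_le M dx); lra.
have /andP[te te'] : 0 <= t0 * e <= e by apply: small => //; lra.
rewrite /quantized_event /setI /= /can_quantize /recover_quant /Defs.decode /=.
rewrite (lm_O2 M) (lm_E M) (lm_S M) (lm_F M); split; first split; first split => //.
- have h1 : (1 - t0) * y <= (1 - t0) * (b + 2 * e) by rewrite ler_pM2l; lra.
  have h2 : t0 * z <= t0 * (c + 5 * e) by rewrite ler_pM2l//; lra.
  lra.
- apply/negP; rewrite -leNgt.
  have h1 : t0 * x <= t0 * (1 - u + 2 * e) by rewrite ler_pM2l//; lra.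
  lra.
- rewrite mulrBl divfK ?gt_eqF//.
  have h1 : (1 - t0) * (a - 4 * e) <= (1 - t0) * f by rewrite ler_pM2l; lra.
  have h2 : t0 * (delta - e) <= t0 * dd by rewrite ler_pM2l//; lra.
  lra.
- by [].
Unshelve. all: by end_near. Qed.

(** [a] bounds the logarithm [f] of [F] from above. The term [- (1 - v)] appears because the direct
    signal interferes with the relay codeword. *)
Lemma outage_ge_unrecovered u v w a q :
  0 <= u -> 0 <= v <= 1 -> 0 <= w -> delta < 1 - u -> 0 <= 1 - u ->
  t0 * (1 - u) < r -> t0 * (1 - v) < r -> 0 <= a -> psi - w - (1 - v) <= a ->
  (1 - t0) * a < r - delta * t0 ->
  u + v + w < q -> \forall rho \near +oo, ((rho `^ (- q))%:E <= out rho)%E.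
Proof.
move=> u0 /andP[v0 v1] w0 hS hu hE hO a0 ha hF uvwq; have [t00 t0lt] := andP t01.
have [e [e0 eS eE eO eF]] : exists e, [/\ 0 < e, 3 * e < 1 - u - delta,
    4 * e <= r - t0 * (1 - u), 4 * e <= r - t0 * (1 - v) &
    7 * e < r - delta * t0 - (1 - t0) * a].
  set m := Num.min (Num.min (1 - u - delta) (r - t0 * (1 - u)))
    (Num.min (r - t0 * (1 - v)) (r - delta * t0 - (1 - t0) * a)).
  have m0 : 0 < m by rewrite !lt_min !subr_gt0 hS hE hO hF.
  have : m <= m by []; rewrite {2}/m !le_min => /andP[/andP[? ?] /andP[? ?]].
  by exists (m / 8); split; lra.
near=> rho; apply: le_trans (outage3_le rho); near: rho.
move: uvwq; apply: (event_prob_ge e0 u0 v0 w0).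
  exact: near_measurable_unrecovered_event.
move=> rho o x y y2 f z rr dd pp U V W M /andP[U1 U2] /andP[V1 V2] /andP[W1 W2].
have /andP[r1 r2] := lm_rr M; have /andP[d1 d2] := lm_dd M; have /andP[p1 p2] := lm_pp M.
have [_ x1] := lm_x M; have [_ y1] := lm_y M.
have x2 : x <= (1 - u + e) + e by apply: (lm_x_le M); lra.
have y2' : y <= (1 - v + e) + e by apply: (lm_y_le M); lra.
have f2 : f <= (a + 4 * e) + e by apply: (lm_f_le M); lra.
have dx : dd < x by lra.
have /andP[te te'] : 0 <= t0 * e <= e by apply: small => //; lra.
rewrite /unrecovered_event /setI /= /can_quantize /recover_quant /Defs.decode /=.
rewrite (lm_O3 M) (lm_E M) (lm_S M) (lm_F M); split; first split; first split => //.
- have h1 : t0 * y <= t0 * (1 - v + 2 * e) by rewrite ler_pM2l//; lra.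
  lra.
- apply/negP; rewrite -leNgt.
  have h1 : t0 * x <= t0 * (1 - u + 2 * e) by rewrite ler_pM2l//; lra.
  lra.
- apply/negP; rewrite -leNgt [leRHS]mulrBl divfK ?gt_eqF//.
  have h1 : (1 - t0) * f <= (1 - t0) * (a + 5 * e) by rewrite ler_pM2l; lra.
  have h2 : t0 * dd <= t0 * (delta + e) by rewrite ler_pM2l//; lra.
  lra.
- by [].
Unshelve. all: by end_near. Qed.

Lemma outage_ge_silent u v a b q :
  0 <= u -> 0 <= v -> 0 <= a -> 1 - u <= a -> a < delta -> t0 * a < r ->
  0 <= b -> 1 - v <= b -> b < r -> u + v < q ->
  \forall rho \near +oo, ((rho `^ (- q))%:E <= out rho)%E.
Proof.
move=> u0 v0 a0 ua hS hE b0 vb hO uvq; have [t00 t0lt] := andP t01.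
have [e [e0 eS eE eO]] : exists e, [/\ 0 < e, 4 * e < delta - a,
    4 * e <= r - t0 * a & 4 * e <= r - b].
  set m := Num.min (Num.min (delta - a) (r - t0 * a)) (r - b).
  have m0 : 0 < m by rewrite !lt_min !subr_gt0 hS hE hO.
  have : m <= m by []; rewrite {2}/m !le_min => /andP[/andP[? ?] ?].
  by exists (m / 8); split; lra.
near=> rho; apply: le_trans (outage4_le rho); near: rho.
move: uvq; rewrite -[u + v]addr0; apply: (event_prob_ge e0 u0 v0 (lexx 0)).
  by near=> rho; exact: measurable_silent_event.
move=> rho o x y y2 f z rr dd pp U V W M /andP[U1 U2] /andP[V1 V2] _.
have /andP[r1 r2] := lm_rr M; have /andP[d1 d2] := lm_dd M.
have x2 : x <= (a + e) + e by apply: (lm_x_le M); lra.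
have y2' : y <= (b + e) + e by apply: (lm_y_le M); lra.
have /andP[te te'] : 0 <= t0 * e <= e by apply: small => //; lra.
rewrite /silent_event /setI /= /can_quantize /Defs.decode /=.
rewrite (lm_O4 M) (lm_E M) (lm_S M); split; first split.
- lra.
- apply/negP; rewrite -leNgt.
  have h1 : t0 * x <= t0 * (a + 2 * e) by rewrite ler_pM2l//; lra.
  lra.
- by apply/negP; rewrite -leNgt; lra.
Unshelve. all: by end_near. Qed.

Let max0 (a : R) : 0 <= Num.max 0 a /\ a <= Num.max 0 a.
Proof. by rewrite !le_max !lexx orbT. Qed.

(** As [t0 >= 1 - t0], outage gives [(1 - t0)(y + y2) <= r], hence [V + W >= 2 - r / (1 - t0)] up to
    errors. *)
Lemma relayed_prob_le_half q : 1 / 2 <= t0 -> q < 2 - r / (1 - t0) ->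
  \forall rho \near +oo, (P (relayed_event rho) <= (rho `^ (- q))%:E)%E.
Proof.
move=> th; have [t00 t0lt] := andP t01; have s0 : 0 < 1 - t0 by lra.
apply: (event_prob_le (C := 2 + (1 - t0)^-1)).
- by rewrite addr_gt0// invr_gt0.
- by near=> rho; exact: measurable_relayed_event.
move=> rho o e x y y2 f z rr dd pp U V W e0 M.
rewrite /relayed_event /= (lm_O1 M) => h.
have /andP[_ r2] := lm_rr M; have [y0 y1] := lm_y M; have [_ y21] := lm_y2 M.
have [U0 _] := max0 U; have [_ V1] := max0 V; have [_ W1] := max0 W.
have h1 : (1 - t0) * y <= t0 * y by apply: ler_wpM2r => //; lra.
have h2 : y + y2 <= (r + e) / (1 - t0).
  by rewrite ler_pdivlMr// mulrC mulrDr; lra.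
rewrite mulrDl in h2; lra.
Unshelve. all: by end_near. Qed.

(** Outage gives [t0 V + (1 - t0) W >= 1 - r], and the left side is at most [t0 (V + W)]. *)
Lemma relayed_prob_le_line q : 1 / 2 <= t0 -> q < (1 - r) / t0 ->
  \forall rho \near +oo, (P (relayed_event rho) <= (rho `^ (- q))%:E)%E.
Proof.
move=> th; have [t00 t0lt] := andP t01; have s0 : 0 < 1 - t0 by lra.
apply: (event_prob_le (C := 2 / t0)).
- by rewrite divr_gt0.
- by near=> rho; exact: measurable_relayed_event.
move=> rho o e x y y2 f z rr dd pp U V W e0 M.
rewrite /relayed_event /= (lm_O1 M) => h.
have /andP[_ r2] := lm_rr M; have [y0 y1] := lm_y M; have [_ y21] := lm_y2 M.
have [U0 _] := max0 U; have [V0 V1] := max0 V; have [W0 W1] := max0 W.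
have h1 : t0 * (1 - Num.max 0 V - e) <= t0 * y by rewrite ler_pM2l//; lra.
have h2 : (1 - t0) * (1 - Num.max 0 W - e) <= (1 - t0) * y2 by rewrite ler_pM2l//; lra.
have h3 : (1 - t0) * Num.max 0 W <= t0 * Num.max 0 W by apply: ler_wpM2r => //; lra.
rewrite [leLHS](_ : _ = (1 - r - 2 * e) / t0); last by ring.
apply: (@le_trans _ _ (Num.max 0 V + Num.max 0 W)); last by lra.
rewrite ler_pdivrMr//; lra.
Unshelve. all: by end_near. Qed.

(** Here [z >= y] forces [y <= r], and failing to decode forces [x <= r / t0]. *)
Lemma quantized_prob_le_simple q : q < 2 - r - r / t0 ->
  \forall rho \near +oo, (P (quantized_event rho) <= (rho `^ (- q))%:E)%E.
Proof.
have [t00 t0lt] := andP t01.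
apply: (event_prob_le (C := 3 + t0^-1)).
- by rewrite addr_gt0// invr_gt0.
- exact: near_measurable_quantized_event.
move=> rho o e x y y2 f z rr dd pp U V W e0 M.
rewrite /quantized_event /setI /= /can_quantize /recover_quant /Defs.decode /=.
rewrite (lm_O2 M) (lm_E M) (lm_S M) (lm_F M) => -[[[h1 /negP h2] _] h4].
rewrite -leNgt in h2.
have /andP[_ r2] := lm_rr M; have [_ y1] := lm_y M; have [_ x1] := lm_x M.
have [yz _] := lm_z M h4.
have [U0 U1] := max0 U; have [_ V1] := max0 V; have [W0 _] := max0 W.
have h5 : t0 * y <= t0 * z by rewrite ler_pM2l.
have h6 : x <= (r + e) / t0 by rewrite ler_pdivlMr// mulrC; lra.
rewrite mulrDl in h6; lra.
Unshelve. all: by end_near. Qed.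

(** From [t0 (x - delta) <= r - (1 - t0) y] one gets [t0 (x + y) <= r + t0 delta + (2 t0 - 1) y]; as
    [y <= r] and [t0 >= 1/2], this yields [x + y <= 2 r + delta]. *)
Lemma quantized_prob_le_half q : 1 / 2 <= t0 -> 0 <= delta ->
  q < 2 - 2 * r - delta ->
  \forall rho \near +oo, (P (quantized_event rho) <= (rho `^ (- q))%:E)%E.
Proof.
move=> th d0; have [t00 t0lt] := andP t01.
apply: (event_prob_le (C := 6)) => //.
  exact: near_measurable_quantized_event.
move=> rho o e x y y2 f z rr dd pp U V W e0 M.
rewrite /quantized_event /setI /= /can_quantize /recover_quant /Defs.decode /=.
rewrite (lm_O2 M) (lm_E M) (lm_S M) (lm_F M) => -[[[h1 _] _] h4].
have /andP[_ r2] := lm_rr M; have [_ y1] := lm_y M; have [_ x1] := lm_x M.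
have /andP[_ d2] := lm_dd M.
have [yz xz] := lm_z M h4.
have {}xz : x - (delta + e) - e <= z by apply: xz; lra.
have [U0 U1] := max0 U; have [_ V1] := max0 V; have [W0 _] := max0 W.
have h5 : t0 * y <= t0 * z by rewrite ler_pM2l.
have h6 : t0 * (x - delta - 2 * e) <= t0 * z by rewrite ler_pM2l//; lra.
have yr : y <= r + e by lra.
have h7 : (2 * t0 - 1) * y <= (2 * t0 - 1) * (r + e) by apply: ler_wpM2l => //; lra.
have h8 : x + y <= 2 * r + delta + 4 * e.
  rewrite -(ler_pM2l t00); lra.
lra.
Unshelve. all: by end_near. Qed.

(** Both [x] and [y] are at most [r / t0]; the third [r / t0] comes from [y] entering [F] as
    interference, through [W >= psi - y - f]. *)
Lemma unrecovered_prob_le q :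
  q < 2 + psi - 3 * (r / t0) - (r - delta * t0) / (1 - t0) ->
  \forall rho \near +oo, (P (unrecovered_event rho) <= (rho `^ (- q))%:E)%E.
Proof.
have [t00 t0lt] := andP t01; have s0 : 0 < 1 - t0 by lra.
apply: (event_prob_le (C := 4 + 3 / t0 + 2 / (1 - t0))).
- by rewrite !addr_gt0// divr_gt0.
- exact: near_measurable_unrecovered_event.
move=> rho o e x y y2 f z rr dd pp U V W e0 M.
rewrite /unrecovered_event /setI /= /can_quantize /recover_quant /Defs.decode /=.
rewrite (lm_O3 M) (lm_E M) (lm_S M) (lm_F M) => -[[[h1 /negP h2] /negP h3] _].
rewrite -leNgt in h2; rewrite -leNgt [leRHS]mulrBl divfK ?gt_eqF// in h3.
have /andP[_ r2] := lm_rr M; have [_ y1] := lm_y M; have [_ x1] := lm_x M.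
have [_ f1] := lm_f M; have /andP[d1 _] := lm_dd M; have /andP[p1 _] := lm_pp M.
have [U0 U1] := max0 U; have [_ V1] := max0 V; have [W0 W1] := max0 W.
have h5 : x <= (r + e) / t0 by rewrite ler_pdivlMr// mulrC; lra.
have h6 : y <= (r + e) / t0 by rewrite ler_pdivlMr// mulrC; lra.
have h7 : t0 * (delta - e) <= t0 * dd by rewrite ler_pM2l//; lra.
have /andP[_ te] : 0 <= t0 * e <= e by apply: small => //; lra.
have h8 : f <= (r - delta * t0 + 2 * e) / (1 - t0) by rewrite ler_pdivlMr// mulrC; lra.
rewrite !mulrDl in h5 h6 h8; rewrite !mulrDl; lra.
Unshelve. all: by end_near. Qed.

(** Always [y <= r]; [x] is bounded by [r / t0] through non-decoding and by [delta] through the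
    failure of [S], and either bound may serve. *)
Lemma silent_prob_le q : q < 2 - r - r / t0 \/ q < 2 - r - delta ->
  \forall rho \near +oo, (P (silent_event rho) <= (rho `^ (- q))%:E)%E.
Proof.
have [t00 t0lt] := andP t01; have it0 : 0 < t0^-1 by rewrite invr_gt0.
have mS : \forall rho \near +oo, measurable (silent_event rho).
  by near=> rho; exact: measurable_silent_event.
case; apply: (event_prob_le (C := 4 + t0^-1)); rewrite ?addr_gt0//;
  move=> rho o e x y y2 f z rr dd pp U V W e0 M;
  rewrite /silent_event /setI /= /can_quantize /Defs.decode /=;
  rewrite (lm_O4 M) (lm_E M) (lm_S M) => -[[h1 /negP h2] /negP h3];
  rewrite -!leNgt in h2 h3;
  have /andP[_ r2] := lm_rr M; have /andP[_ d2] := lm_dd M;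
  have [_ y1] := lm_y M; have [_ x1] := lm_x M;
  have [U0 U1] := max0 U; have [_ V1] := max0 V; have [W0 _] := max0 W.
- have h6 : x <= (r + e) / t0 by rewrite ler_pdivlMr// mulrC; lra.
  rewrite mulrDl in h6; lra.
- have : 0 < t0^-1 * e by rewrite mulr_gt0.
  lra.
Unshelve. all: by end_near. Qed.

(** Not decoding means [1 + alpha0 * rho * G01 <= K], whereas [S] puts the same quantity above
    [Delta^2]. This holds at each [rho], so it also settles the tie of exponents. *)
Lemma not_decode_can_quantize_eq0 rho : 0 < rho -> code_size t0 rate rho <= dist rho ->
  ~` E rho `&` S rho = set0.
Proof.
move=> rho0 Kd; have [t00 _] := andP t01.
apply/seteqP; split => // o []; rewrite /can_quantize /Defs.decode /=.
move=> /negP; rewrite -leNgt => h1 h2.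
have A0 : 0 < 1 + alpha0 * rho * G01 o.
  by apply: (lt_le_trans ltr01); rewrite lerDl !mulr_ge0 ?G01_ge0// ltW.
have h : 1 + alpha0 * rho * G01 o <= code_size t0 rate rho.
  rewrite -[leLHS]lnK ?posrE// /code_size ler_expR ler_pdivlMr// mulrC.
  exact: h1.
by move: h2; rewrite addrC ltNge (le_trans h Kd).
Qed.

Lemma relay_prob_eq0 : (\forall rho \near +oo, code_size t0 rate rho <= dist rho) ->
  (forall q, \forall rho \near +oo, (P (quantized_event rho) <= (rho `^ (- q))%:E)%E) /\
  (forall q, \forall rho \near +oo, (P (unrecovered_event rho) <= (rho `^ (- q))%:E)%E).
Proof.
move=> Kd; split => q; near=> rho;
  (have e0 : ~` E rho `&` S rho = set0
    by apply: not_decode_can_quantize_eq0; [near: rho; exact: near_pinfty_gt|near: rho]).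
- rewrite (_ : quantized_event rho = set0) ?measure0 ?lee_fin ?powR_ge0//.
  by apply/seteqP; split => // o [[[_ nE] _] So]; rewrite -e0.
- rewrite (_ : unrecovered_event rho = set0) ?measure0 ?lee_fin ?powR_ge0//.
  by apply/seteqP; split => // o [[[_ nE] _] So]; rewrite -e0.
Unshelve. all: by end_near. Qed.

Lemma near_code_size_le : r / t0 < delta ->
  \forall rho \near +oo, code_size t0 rate rho <= dist rho.
Proof.
move=> rd; have [t00 _] := andP t01; have [dist0 dist_cvg] := dist_expo.
(* The solution of [delta - e = (r + e) / t0]. *)
set e := (delta - r / t0) / (1 + t0^-1).
have it : 0 < 1 + t0^-1 by rewrite addr_gt0// invr_gt0.
have e0 : 0 < e by rewrite divr_gt0// subr_gt0.
have ee : delta - e = (r + e) / t0.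
  by rewrite /e; field; rewrite !gt_eqF//= addr_gt0.
near=> rho.
have rho1 : 1 < rho by near: rho; exact: near_pinfty_gt.
have L0 : 0 < ln rho by exact: ln_gt0.
have D0 : 0 < dist rho by near: rho.
have /andP[_ h1] : r - e <= rate rho / ln rho <= r + e by near: rho; exact: near_ratio.
have /andP[h2 _] : delta - e <= ln (dist rho) / ln rho <= delta + e
  by near: rho; exact: (near_ratio e0 dist_cvg).
rewrite /code_size -[leRHS]lnK ?posrE// ler_expR.
rewrite -(ler_pM2r (_ : 0 < (ln rho)^-1)) ?invr_gt0//; apply: le_trans h2.
by rewrite ee mulrAC ler_pM2r ?invr_gt0.
Unshelve. all: by end_near. Qed.

End outage_events.

(** * Bounds on the exponent for fixed parameters *)

Section dmt_bounds.
Context {R : realType} {d : measure_display} {T : measurableType d}.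
Variables (P : probability T R) (G01 G02 G12 : T -> R).
Hypotheses (f01 : fading_gain P G01) (f02 : fading_gain P G02)
  (f12 : fading_gain P G12) (ind : independent_gains P G01 G02 G12).
Variables (alpha0 alpha1 t0 r delta : R) (rate dist phi : R -> R).
Hypotheses (alpha0_gt0 : 0 < alpha0) (alpha1_gt0 : 0 < alpha1) (t01 : 0 < t0 < 1).
Hypothesis r01 : 0 <= r <= 1.
Hypothesis rate_r : rate rho / ln rho @[rho --> +oo] --> r.
Hypothesis rate_expo : r = 0 -> expo_eq rate 0.
Hypotheses (dist_expo : expo_eq dist delta)
  (phi_expo : expo_eq phi (1 + pos_part (1 - r / t0))).
Implicit Types (rho q c : R) (l : \bar R).

Local Notation out := (outage P G01 G02 G12 alpha0 alpha1 t0 rate dist phi).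
Local Notation is_dmt := (has_dmt P G01 G02 G12 alpha0 alpha1 t0 rate dist phi).

(** The exponent is at most [c], in a form that does not presuppose a limit. *)
Definition outage_reaches c : Prop := forall q, c < q ->
  \forall rho \near +oo, ((rho `^ (- q))%:E <= out rho)%E.

Lemma outage_reaches_le c c' : c <= c' -> outage_reaches c -> outage_reaches c'.
Proof. by move=> cc h q cq; apply: h; exact: le_lt_trans cq. Qed.

Lemma dmt_le_of_reaches c l : outage_reaches c -> is_dmt l -> (l <= c%:E)%E.
Proof.
move=> h hl; apply/lee_addgt0Pr => e e0.
by rewrite -EFinD; apply: (decay_exponent_le hl); apply: h; lra.
Qed.

Let t00 : 0 < t0. Proof. by case/andP: t01. Qed.
Let s0 : 0 < 1 - t0. Proof. by rewrite subr_gt0; case/andP: t01. Qed.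
Let r0 : 0 <= r. Proof. by case/andP: r01. Qed.
Let r1 : r <= 1. Proof. by case/andP: r01. Qed.

Let silent := outage_ge_silent f01 f02 f12 ind alpha0_gt0 alpha1_gt0 t01 rate_r
  dist_expo phi_expo.
Let unrecovered := outage_ge_unrecovered f01 f02 f12 ind alpha0_gt0 alpha1_gt0 t01
  rate_r dist_expo phi_expo.
Let quantized := outage_ge_quantized f01 f02 f12 ind alpha0_gt0 alpha1_gt0 t01
  rate_r dist_expo phi_expo.
Let relayed := outage_ge_relayed f01 f02 f12 ind alpha0_gt0 alpha1_gt0 t01 rate_r
  dist_expo phi_expo.

Let pos4 (a b c e : R) : 0 < a -> 0 < b -> 0 < c -> 0 < e ->
  exists h, [/\ 0 < h, h <= a, h <= b, h <= c & h <= e].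
Proof.
move=> a0 b0 c0 e0; set m := Num.min (Num.min a b) (Num.min c e).
have m0 : 0 < m by rewrite !lt_min a0 b0 c0.
have : m <= m by []; rewrite {2}/m !le_min => /andP[/andP[? ?] /andP[? ?]].
by exists m.
Qed.

Let psiE : r < t0 -> 1 + pos_part (1 - r / t0) = 2 - r / t0.
Proof.
move=> rt; have k1 : r / t0 <= 1 by rewrite ler_pdivrMr// mul1r ltW.
by rewrite /pos_part max_r ?subr_ge0//; ring.
Qed.

Let psi1 : t0 <= r -> 1 + pos_part (1 - r / t0) = 1.
Proof.
move=> tr; have k1 : 1 <= r / t0 by rewrite ler_pdivlMr// mul1r.
by rewrite /pos_part max_l ?subr_le0// addr0.
Qed.

(** For [t0 <= r], slightly weakened gains already prevent decoding. If [delta < 1] the relay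
    quantizes, but with power of order [rho] its signal is drowned by the direct one, at cost 0; if
    [delta >= 1] it is silent and the direct link must lose [1 - r]. *)
Lemma reaches_no_decode : t0 <= r -> outage_reaches (1 - r).
Proof.
have [T0 S0 R0 R1] := And4 t00 s0 r0 r1.
move=> tr q qr; have rpos : 0 < r by exact: lt_le_trans tr.
have [d1|d1] := ltrP delta 1.
  have dt : 0 < r - delta * t0.
    have : delta * t0 < 1 * t0 by rewrite ltr_pM2r.
    lra.
  have [h [h0 h1 h2 h3 h4]] : exists h, [/\ 0 < h, h <= q / 4,
    h <= (1 - delta) / 2, h <= (r - delta * t0) / 2 & h <= 1] by apply: pos4; lra.
  have th : 0 < t0 * h by rewrite mulr_gt0.
  have sh : (1 - t0) * h <= h by rewrite ler_piMl ?ltW//; lra.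
  apply: (@unrecovered h h 0 h); rewrite ?psi1 ?mulrBr//; lra.
have [h [h0 h1 h2 _ _]] : exists h, [/\ 0 < h, h <= (q - (1 - r)) / 4,
    h <= r, h <= r & h <= r] by apply: pos4; lra.
have th : 0 < t0 * h by rewrite mulr_gt0.
apply: (@silent h (1 - r + h) (1 - h) (r - h)); rewrite ?mulrBr; lra.
Qed.

(** Witness: [y = y2 = r], both links equally weak. *)
Lemma reaches_symmetric : r < t0 -> outage_reaches (2 * (1 - r)).
Proof.
have [T0 S0 R0 R1] := And4 t00 s0 r0 r1.
move=> rt q qr; have [rpos|] := ltrP 0 r; last first.
  move=> rle; have re0 : r = 0 by apply/eqP; rewrite eq_le r0 rle.
  apply: (outage_ge_relayed0 f01 f02 f12 ind alpha0_gt0 alpha1_gt0 t01 rate_r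
    dist_expo phi_expo re0 (rate_expo re0)).
  by move: qr; rewrite re0; lra.
have [h [h0 h1 h2 _ _]] : exists h, [/\ 0 < h, h <= (q - 2 * (1 - r)) / 4,
    h <= r, h <= r & h <= r] by apply: pos4; lra.
apply: (@relayed (1 - r + h) (1 - r + h) (r - h) (r - h)) => //; lra.
Qed.

(** Witness: a dead direct link, [y = 0], and [y2 = r / (1 - t0)]. *)
Lemma reaches_relay_line : r < t0 -> 0 < r -> r <= 1 - t0 ->
  outage_reaches (2 - r / (1 - t0)).
Proof.
have [T0 S0 R0 R1] := And4 t00 s0 r0 r1.
move=> rt rpos rs q qr.
have k0 : 0 < r / (1 - t0) by rewrite divr_gt0.
have k1 : r / (1 - t0) <= 1 by rewrite ler_pdivrMr// mul1r.
have ks : (1 - t0) * (r / (1 - t0)) = r by rewrite mulrC divfK// gt_eqF.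
have [h [h0 h1 h2 _ _]] : exists h, [/\ 0 < h, h <= (q - (2 - r / (1 - t0))) / 4,
    h <= r / (1 - t0), h <= r / (1 - t0) & h <= r / (1 - t0)] by apply: pos4; lra.
have sh : 0 < (1 - t0) * h by rewrite mulr_gt0.
apply: (@relayed 1 (1 - r / (1 - t0) + h) 0 (r / (1 - t0) - h)) => //; rewrite ?mulrBr; lra.
Qed.

(** Witness: a perfect relay link, [y2 = 1], with [t0 y = r - (1 - t0)]. *)
Lemma reaches_direct_line : r < t0 -> 1 - t0 <= r -> outage_reaches ((1 - r) / t0).
Proof.
have [T0 S0 R0 R1] := And4 t00 s0 r0 r1.
move=> rt sr; have rpos : 0 < r by exact: lt_le_trans sr.
(* The witness needs [k < 1]; on the boundary [r = 1 - t0] both lines give 1. *)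
have [rs|rs] := lerP r (1 - t0).
  have re : r = 1 - t0 by lra.
  apply: outage_reaches_le (reaches_relay_line rt rpos rs).
  by rewrite re divff ?gt_eqF// opprB addrCA subrr addr0 divff ?gt_eqF//; lra.
move=> q qr; set k := (1 - r) / t0 in qr *.
have k0 : 0 <= k by rewrite divr_ge0//; lra.
have k1 : k < 1 by rewrite ltr_pdivrMr// mul1r; lra.
have ks : t0 * k = 1 - r by rewrite mulrC divfK// gt_eqF.
have [h [h0 h1 h2 _ _]] : exists h, [/\ 0 < h, h <= (q - k) / 4,
    h <= 1 - k, h <= 1 & h <= 1] by apply: pos4; lra.
have th : 0 < t0 * h by rewrite mulr_gt0.
apply: (@relayed (k + h) 0 (1 - k - h) 1) => //; rewrite ?mulrBr; lra.
Qed.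

(* Which of the three events of the undecoded regime is used depends on how
   [delta] compares with [r / t0] and [c - 2 * r]. *)
Lemma reaches_quantize c : 0 < r -> r < t0 -> c <= r + r / t0 -> 2 * r <= c ->
  2 + c <= 4 * (r / t0) + (r - (c - 2 * r) * t0) / (1 - t0) ->
  outage_reaches (2 - c).
Proof.
have [T0 S0 R0 R1] := And4 t00 s0 r0 r1.
move=> rpos rt ck cr c3 q qc.
set k := r / t0 in ck c3.
have kt : t0 * k = r by rewrite mulrC divfK// gt_eqF.
have k0 : 0 < k by rewrite divr_gt0.
have k1 : k < 1 by rewrite ltr_pdivrMr// mul1r.
have rk : r <= k by rewrite ler_pdivlMr// ger_pMr//; lra.
have psi : 1 + pos_part (1 - r / t0) = 2 - k by exact: psiE.
(* For [delta >= k] the relay is silent at [x] just below [k] and [y] just below [r], at cost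
   [2 - r - k]. *)
have [dk|kd] := ltrP delta k; last first.
  have [h [h0 h1 h2 h3 _]] : exists h, [/\ 0 < h, h <= (q - (2 - c)) / 4,
    h <= r, h <= k & h <= k] by apply: pos4; lra.
  have th : 0 < t0 * h by rewrite mulr_gt0.
  apply: (@silent (1 - k + h) (1 - r + h) (k - h) (r - h)); rewrite ?mulrBr; lra.
set m := (r - delta * t0) / (1 - t0).
have sm : (1 - t0) * m = r - delta * t0 by rewrite mulrC divfK// gt_eqF.
have m0 : 0 < m.
  rewrite divr_gt0// subr_gt0 -kt mulrC ltr_pM2l//.
(* Losing the quantized signal at [x = y = k], [f = m] costs [2 - 2k + max(0, 2 - 2k - m)]. The last
   hypothesis bounds this at [delta = c - 2r], and [m] decreases in [delta]. *)
have [cheap|] := boolP ((2 - 2 * k <= m) || (delta <= c - 2 * r)).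
  have cost : 2 - 2 * k + Num.max 0 (2 - 2 * k - m) <= 2 - c.
    case: (lerP (2 - 2 * k) m) cheap => [km _|km /= dc].
      by rewrite max_l; lra.
    have : (r - (c - 2 * r) * t0) / (1 - t0) <= m.
      rewrite ler_pM2r ?invr_gt0// lerD2l lerN2 ler_pM2r//.
    rewrite max_r; lra.
  have mm0 : 0 <= Num.max 0 (2 - 2 * k - m) by rewrite le_max lexx.
  have mm1 : 2 - 2 * k - m <= Num.max 0 (2 - 2 * k - m) by rewrite le_max lexx orbT.
  set mm := Num.max 0 _ in cost mm0 mm1.
  have [h [h0 h1 h2 h3 h4]] : exists h, [/\ 0 < h, h <= (q - (2 - c)) / 8,
    h <= k, h <= (k - delta) / 2 & h <= m] by apply: pos4; lra.
  have th : 0 < t0 * h by rewrite mulr_gt0.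
  have sh : 0 < (1 - t0) * h by rewrite mulr_gt0.
  apply: (@unrecovered (1 - k + h) (1 - k + h) (mm + 2 * h) (m - h));
    rewrite ?psi ?mulrBr; lra.
rewrite negb_or -!ltNge => /andP[mk cd].
(* Now [m < 2 - 2k <= 2 - k - r], so the signal is recovered at [W = 0]. With [y = r], [z] is the
   largest [x] compatible with non-decoding and with [x - delta <= r]. *)
set z := Num.min k (r + delta).
have zk : z <= k by rewrite ge_min lexx.
have zr : z <= r + delta by rewrite ge_min lexx orbT.
have zd : delta < z by rewrite lt_min dk; lra.
have zc : c <= z + r by rewrite -lerBlDr le_min; lra.
have [h [h0 h1 h2 h3 _]] : exists h, [/\ 0 < h, h <= (q - (2 - c)) / 8,
    h <= r, h <= (z - delta) / 2 & h <= m] by apply: pos4; lra.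
have th : 0 < t0 * h by rewrite mulr_gt0.
have tz : t0 * z <= t0 * k by rewrite ler_pM2l.
have sa : (1 - t0) * m < (1 - t0) * (2 - k - r + h) by rewrite ltr_pM2l//; lra.
apply: (@quantized (1 - z + h) (1 - r + h) (2 - k - r + h) (r - h) (r - h));
  rewrite ?psi; lra.
Qed.

Let relayed_half := relayed_prob_le_half f01 f02 f12 ind alpha0_gt0 alpha1_gt0 t01
  rate_r dist_expo phi_expo.
Let relayed_line := relayed_prob_le_line f01 f02 f12 ind alpha0_gt0 alpha1_gt0 t01
  rate_r dist_expo phi_expo.
Let quantized_simple := quantized_prob_le_simple f01 f02 f12 ind alpha0_gt0
  alpha1_gt0 t01 rate_r dist_expo phi_expo.
Let quantized_half := quantized_prob_le_half f01 f02 f12 ind alpha0_gt0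
  alpha1_gt0 t01 rate_r dist_expo phi_expo.
Let unrecovered_le := unrecovered_prob_le f01 f02 f12 ind alpha0_gt0
  alpha1_gt0 t01 rate_r dist_expo phi_expo.
Let silent_le := silent_prob_le f01 f02 f12 ind alpha0_gt0
  alpha1_gt0 t01 rate_r dist_expo phi_expo.

Lemma dmt_balanced c : outage_reaches c -> 1 / 2 <= t0 -> r < t0 -> 0 <= delta ->
  c <= 2 - r / (1 - t0) -> c <= 2 - 2 * r - delta ->
  c <= 4 - 4 * (r / t0) - (r - delta * t0) / (1 - t0) ->
  is_dmt c%:E.
Proof.
move=> hc th rt d0 c1 c2 c3.
apply: (outage_dmt_intro f01); first exact: hc.
- by move=> q qc; apply: relayed_half => //; exact: lt_le_trans c1.
- by move=> q qc; apply: quantized_half => //; exact: lt_le_trans c2.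
- by move=> q qc; apply: unrecovered_le; rewrite psiE//; lra.
- by move=> q qc; apply: silent_le; right; have := r0; lra.
Qed.

(** The undecoded link is bounded by [x <= r / t0] alone, so the distortion matters only for the
    unrecovered event: empty under [K <= Delta^2], of cost [4 - 4 r / t0] at the tie. *)
Lemma dmt_simple c : outage_reaches c -> 1 / 2 <= t0 -> r < t0 ->
  c <= 2 - r / (1 - t0) \/ c <= (1 - r) / t0 -> c <= 2 - r - r / t0 ->
  (\forall rho \near +oo, code_size t0 rate rho <= dist rho) \/
    (delta = r / t0 /\ c <= 4 - 4 * (r / t0)) ->
  is_dmt c%:E.
Proof.
move=> hc th rt c1 c2 c3.
apply: (outage_dmt_intro f01); first exact: hc.
- move=> q qc; case: c1 => c1; first by apply: relayed_half => //; exact: lt_le_trans c1.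
  by apply: relayed_line => //; exact: lt_le_trans c1.
- by move=> q qc; apply: quantized_simple; exact: lt_le_trans c2.
- move=> q qc; case: c3 => [Kd|[dE c3]].
    have [_ h] := relay_prob_eq0 G02 G12 f01 phi alpha0_gt0 t01 Kd.
    exact: h.
  apply: unrecovered_le; rewrite psiE// dE divfK ?gt_eqF// subrr mul0r; lra.
- by move=> q qc; apply: silent_le; left; exact: lt_le_trans c2.
Qed.

Lemma dmt_trivial : outage_reaches 0 -> is_dmt 0%:E.
Proof.
move=> h0; have le1 : forall A : R -> set T, (\forall rho \near +oo, measurable (A rho)) ->
  forall q, q < 0 -> \forall rho \near +oo, (P (A rho) <= (rho `^ (- q))%:E)%E.
  move=> A mA q q0; near=> rho; apply: (@le_trans _ _ 1%E).
    by apply: probability_le1; near: rho.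
  by rewrite lee_fin; near: rho; apply: near_powR_ge; rewrite oppr_gt0.
apply: (outage_dmt_intro f01); first exact: h0.
- apply: le1; near=> rho; apply: measurable_relayed_event; eassumption.
- apply: le1; apply: near_measurable_quantized_event; eassumption.
- apply: le1; apply: near_measurable_unrecovered_event; eassumption.
- apply: le1; near=> rho; apply: measurable_silent_event; eassumption.
Unshelve. all: by end_near. Qed.

End dmt_bounds.

(** * Optimization of the parameters *)

Section constants.
Context {R : realType}.
Implicit Types r t v : R.

(** [9 / 4] and [38 / 17] are consecutive convergents of the square root of 5. *)
Lemma sqrt5_constants : exists q : R,
  [/\ q ^+ 2 = 5, 38 / 17 < q < 9 / 4, golden = 2 / (q + 1),
      r_mid = 2 * (q - 1) / (9 - q) & r_high = (q - 1) / (q + 1)]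
  /\ Num.sqrt 5 = q.
Proof.
have [q [q0 q2 qE]] : exists q : R, [/\ 0 <= q, q ^+ 2 = 5 & Num.sqrt 5 = q].
  by exists (Num.sqrt 5); rewrite sqrtr_ge0 sqr_sqrtr.
exists q; rewrite /golden /r_mid /r_high qE; split=> //; split=> //.
by apply/andP; split; nra.
Qed.

(** All constants become rational in the root [g] of [g^2 + g = 1]; [8 / 13] and [5 / 8] are
    Fibonacci quotients around it. *)
Lemma golden_facts : exists g : R,
  [/\ golden = g, 8 / 13 < g < 5 / 8, g ^+ 2 = 1 - g,
      r_high = 1 - g & r_mid * (4 - g) = 2 * g]
  /\ forall r, 2 / (3 - Num.sqrt 5) * r = r / (1 - g).
Proof.
have [q [[q2 /andP[ql qu] -> -> ->] ->]] := sqrt5_constants.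
have q1 : q + 1 != 0 by rewrite gt_eqF//; lra.
exists ((q - 1) / 2); split; last first.
  by move=> r; field; rewrite !gt_eqF//; lra.
split.
- by apply/eqP; rewrite eqr_div// ?pnatr_eq0//; apply/eqP; ring: q2.
- by apply/andP; split; lra.
- by field: q2.
- by apply: (mulIf q1); rewrite divfK//; field: q2.
- by field; rewrite gt_eqF//; lra.
Qed.

Lemma r_mid_bounds : 1 / 3 < (r_mid : R) < 3 / 8.
Proof.
have [g [[_ /andP[gl gu] _ _ e] _]] := golden_facts.
by move: (r_mid) e => m e; apply/andP; split; nra.
Qed.

Definition vstar_cubic r v : R :=
  2 * (1 + r) * v ^+ 3 - (4 + 5 * r) * v ^+ 2 + 2 * (1 + 4 * r) * v - 4 * r.

(** Modulo [g^2 = 1 - g] the cubic is affine in [r], equal to [(11 - 17 g)(m - r)]: [r_mid] is where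
    the root reaches the golden value. *)
Lemma vstar_cubic_golden r g m : g ^+ 2 = 1 - g -> 8 / 13 < g < 5 / 8 ->
  m * (4 - g) = 2 * g ->
  (0 <= vstar_cubic r g) = (r <= m) /\ (vstar_cubic r g <= 0) = (m <= r).
Proof.
move=> g2 /andP[gl gu] e.
have g4 : 0 < 4 - g by lra.
have -> : vstar_cubic r g = (11 - 17 * g) * (m - r).
  apply: (mulIf (lt0r_neq0 g4)).
  have -> : (11 - 17 * g) * (m - r) * (4 - g) = (11 - 17 * g) * (m * (4 - g) - r * (4 - g)) by ring.
  by rewrite e /vstar_cubic; ring: g2.
have g11 : 0 < 11 - 17 * g by lra.
by rewrite pmulr_rge0// pmulr_rle0// subr_ge0 subr_le0.
Qed.

(** The divided difference is bounded below by a quadratic in [v + v'], positive because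
    [23 r^2 + 20 r - 4 > 0]; the cubic is thus injective on the whole line. *)
Lemma vstar_cubic_inj r v v' : 1 / 4 <= r ->
  vstar_cubic r v = vstar_cubic r v' -> v = v'.
Proof.
move=> r4 e; set m := v + v'.
have f : (v - v') * (2 * (1 + r) * (v ^+ 2 + v * v' + v' ^+ 2)
    - (4 + 5 * r) * m + 2 * (1 + 4 * r)) = 0.
  move/eqP: e; rewrite -subr_eq0 => /eqP <-; rewrite /vstar_cubic /m; ring.
have sq : 3 / 4 * m ^+ 2 <= v ^+ 2 + v * v' + v' ^+ 2.
  by have := sqr_ge0 (v - v'); rewrite /m; lra.
have p1 : 2 * (1 + r) * (3 / 4 * m ^+ 2) <= 2 * (1 + r) * (v ^+ 2 + v * v' + v' ^+ 2).
  by apply: ler_wpM2l => //; lra.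
have p2 : 0 < 2 * (1 + r) * (3 / 4 * m ^+ 2) - (4 + 5 * r) * m + 2 * (1 + 4 * r).
  have a0 : 0 < 6 * (1 + r) by lra.
  rewrite -(pmulr_rgt0 _ a0).
  have -> : 6 * (1 + r) * (2 * (1 + r) * (3 / 4 * m ^+ 2) - (4 + 5 * r) * m + 2 * (1 + 4 * r))
    = (3 * (1 + r) * m - (4 + 5 * r)) ^+ 2 + (23 * r ^+ 2 + 20 * r - 4) by field.
  have := sqr_ge0 (3 * (1 + r) * m - (4 + 5 * r)); nra.
apply/eqP; rewrite -subr_eq0; apply/eqP.
have /eqP := f; rewrite mulf_eq0 => /orP[/eqP//|/eqP]; lra.
Qed.

Lemma is_vstarE r v :
  is_vstar r v <-> 1 / 2 <= v <= golden /\ vstar_cubic r v = 0.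
Proof. by []. Qed.

Lemma ex_vstar r : r_low < r <= r_mid -> exists v, is_vstar r v.
Proof.
rewrite /r_low => /andP[rl rm].
have [g [[gE gb g2 _ e] _]] := golden_facts.
pose p : {poly R} := (2 * (1 + r))%:P * 'X ^+ 3 - (4 + 5 * r)%:P * 'X ^+ 2
  + (2 * (1 + 4 * r))%:P * 'X - (4 * r)%:P.
have pE v : p.[v] = vstar_cubic r v by rewrite /p /vstar_cubic !hornerE.
have /andP[gl _] := gb; have [h _] := vstar_cubic_golden r g2 gb e.
have [|| v vI /rootP] := @poly_ivt _ p (1 / 2) g.
- lra.
(* At [1/2] the cubic equals [(1 - 4 r) / 4], which explains the threshold [r_low]. *)
- rewrite !pE h rm andbT /vstar_cubic; lra.
by rewrite pE => v0; exists v; split => //; rewrite gE.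
Qed.

Lemma ex_unique_vstar r : r_low < r <= r_mid -> exists! v, is_vstar r v.
Proof.
move=> rr; have [v vP] := ex_vstar rr; exists v; split => // v' v'P.
have /andP[rl _] := rr; apply: (@vstar_cubic_inj r); first by move: rl; rewrite /r_low; lra.
have [_ v0] := (is_vstarE _ _).1 vP; have [_ v'0] := (is_vstarE _ _).1 v'P.
by rewrite v0 v'0.
Qed.

Lemma vstarP r : r_low < r <= r_mid -> is_vstar r (vstar r).
Proof. by move=> /ex_vstar[v vP]; exact: (xgetPex 0 (ex_intro _ v vP)). Qed.

(* Clearing denominators, [2 + c <= 4 r / t + (r - (c - 2 r) t) / (1 - t)]
   becomes the nonnegativity of a quadratic in [t], equal at [t = v] to
   [- vstar_cubic r v] up to a positive factor. *)
Lemma quantize_tradeoff_mid r v t : 1 / 4 <= r -> 1 / 2 <= v -> v ^+ 2 + v <= 1 ->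
  vstar_cubic r v <= 0 -> 0 < t -> t < v ->
  [/\ r / (1 - v) <= r + r / t, 2 * r <= r / (1 - v) &
      2 + r / (1 - v) <= 4 * (r / t) + (r - (r / (1 - v) - 2 * r) * t) / (1 - t)].
Proof.
move=> r4 v2 v21 pv t0 tv.
have v6 : v <= 5 / 8 by nra.
have s0 : 0 < 1 - v by lra.
have c2 : 2 * r <= r / (1 - v) by rewrite ler_pdivlMr//; nra.
set c := r / (1 - v) in c2 *.
have cE : c * (1 - v) = r by rewrite divfK// gt_eqF.
split=> //.
  (* The claim amounts to [v (1 + t) <= 1], which follows from [t < v] and [v^2 + v <= 1]. *)
  rewrite ler_pdivrMr//; set k := r / t.
  have kt : k * t = r by rewrite divfK// gt_eqF.
  have k0 : 0 < k by rewrite divr_gt0//; lra.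
  have h1 : k * (t * (1 + v)) <= k * 1 by rewrite ler_pM2l//; nra.
  nra.
have tt : 0 < t * (1 - t) by rewrite mulr_gt0//; lra.
rewrite -subr_ge0 -(pmulr_lge0 _ tt).
have -> : (4 * (r / t) + (r - (c - 2 * r) * t) / (1 - t) - (2 + c)) * (t * (1 - t))
    = 4 * r - t * (3 * r + 2 + c) + t ^+ 2 * (2 + 2 * r).
  by field; rewrite !gt_eqF//; lra.
have Qv : 0 <= 4 * r - v * (3 * r + 2 + c) + v ^+ 2 * (2 + 2 * r).
  rewrite -(pmulr_lge0 _ s0).
  have -> : (4 * r - v * (3 * r + 2 + c) + v ^+ 2 * (2 + 2 * r)) * (1 - v)
      = - vstar_cubic r v + v * (r - c * (1 - v)) by rewrite /vstar_cubic; ring.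
  by rewrite cE; lra.
(* The vertex of the quadratic lies beyond [v], so it decreases from [t] to [v]. *)
apply: le_trans Qv _; rewrite -subr_ge0.
have -> : 4 * r - t * (3 * r + 2 + c) + t ^+ 2 * (2 + 2 * r)
    - (4 * r - v * (3 * r + 2 + c) + v ^+ 2 * (2 + 2 * r))
    = (v - t) * (3 * r + 2 + c - (2 + 2 * r) * (t + v)) by ring.
apply: mulr_ge0; first lra.
have h1 : (2 + 2 * r) * (t + v) <= (2 + 2 * r) * (2 * v) by rewrite ler_pM2l; lra.
have h2 : r * v <= r * (5 / 8) by rewrite ler_pM2l; lra.
lra.
Qed.

(** Here [c = 3 r - r^2], so that [2 - c = (2 - r)(1 - r)]; again a quadratic in [t] must be
    nonnegative, now up to [1 / (2 - r)]. *)
Lemma quantize_tradeoff_high r t : r ^+ 2 - 3 * r + 1 <= 0 -> 0 < r <= 1 ->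
  0 < t < 1 -> t * (2 - r) < 1 ->
  2 + (3 * r - r ^+ 2) <= 4 * (r / t) + (r - (3 * r - r ^+ 2 - 2 * r) * t) / (1 - t).
Proof.
move=> r2 /andP[r0 r1] /andP[t0 t1] tr.
have tt : 0 < t * (1 - t) by rewrite mulr_gt0//; lra.
rewrite -subr_ge0 -(pmulr_lge0 _ tt).
have -> : (4 * (r / t) + (r - (3 * r - r ^+ 2 - 2 * r) * t) / (1 - t)
      - (2 + (3 * r - r ^+ 2))) * (t * (1 - t))
    = 4 * r - t * (2 + 6 * r - r ^+ 2) + t ^+ 2 * (2 + 2 * r).
  by field; rewrite !gt_eqF//; lra.
have r38 : 3 / 8 < r by nra.
(* Above [4/5] the discriminant is negative. Below, the vertex lies beyond [T = 1 / (2 - r)], and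
   the value at [T] is positive as [r > 3/8]. *)
have [r8|r8] := lerP r (4 / 5); last first.
  have a0 : 0 < 8 * (1 + r) by lra.
  rewrite -(pmulr_lge0 _ a0).
  have -> : (4 * r - t * (2 + 6 * r - r ^+ 2) + t ^+ 2 * (2 + 2 * r)) * (8 * (1 + r))
    = (4 * (1 + r) * t - (2 + 6 * r - r ^+ 2)) ^+ 2
      + (32 * r * (1 + r) - (2 + 6 * r - r ^+ 2) ^+ 2) by ring.
  rewrite addr_ge0 ?sqr_ge0// subr_ge0.
  have h1 : 0 <= 2 + 6 * r - r ^+ 2 <= 7 by apply/andP; split; nra.
  have h2 : (2 + 6 * r - r ^+ 2) ^+ 2 <= 7 * (2 + 6 * r - r ^+ 2) by nra.
  nra.
have s0 : 0 < 2 - r by lra.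
set T := (2 - r)^-1.
have TE : T * (2 - r) = 1 by rewrite mulVf// gt_eqF.
have tT : t < T by rewrite -(ltr_pM2r s0) TE.
have T0 : 0 < T by rewrite invr_gt0.
have QT : 0 <= 4 * r - T * (2 + 6 * r - r ^+ 2) + T ^+ 2 * (2 + 2 * r).
  have -> : 4 * r - T * (2 + 6 * r - r ^+ 2) + T ^+ 2 * (2 + 2 * r)
    = T ^+ 2 * (- 2 + 8 * r - 8 * r ^+ 2 + 3 * r ^+ 3).
    by rewrite /T; field; rewrite gt_eqF.
  apply: mulr_ge0; first exact: sqr_ge0.
  have -> : - 2 + 8 * r - 8 * r ^+ 2 + 3 * r ^+ 3 =
    (r - 3 / 8) * (3 * r ^+ 2 - 55 / 8 * r + 347 / 64) + 17 / 512 by field.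
  have : 0 < 3 * r ^+ 2 - 55 / 8 * r + 347 / 64 by nra.
  nra.
apply: le_trans QT _; rewrite -subr_ge0.
have -> : 4 * r - t * (2 + 6 * r - r ^+ 2) + t ^+ 2 * (2 + 2 * r)
    - (4 * r - T * (2 + 6 * r - r ^+ 2) + T ^+ 2 * (2 + 2 * r))
    = (T - t) * (2 + 6 * r - r ^+ 2 - (2 + 2 * r) * (t + T)) by ring.
apply: mulr_ge0; first lra.
have h1 : (2 + 2 * r) * (t + T) <= (2 + 2 * r) * (2 * T) by rewrite ler_pM2l; lra.
have h2 : 0 <= T * ((2 + 6 * r - r ^+ 2) * (2 - r) - (4 + 4 * r)).
  by apply: mulr_ge0; [exact: ltW|nra].
have h3 : T * ((2 + 6 * r - r ^+ 2) * (2 - r) - (4 + 4 * r)) =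
  (2 + 6 * r - r ^+ 2) * (T * (2 - r)) - (2 + 2 * r) * (2 * T) by ring.
rewrite h3 TE in h2; lra.
Qed.

(** The roots of [r^2 - 3 r + 1] are [1 - g], which is [r_high], and [2 + g]. *)
Lemma r_high_gt r : r_high < r <= 1 -> r ^+ 2 - 3 * r + 1 <= 0.
Proof.
have [g [[_ /andP[gl gu] g2 -> _] _]] := golden_facts => /andP[h r1].
have -> : r ^+ 2 - 3 * r + 1 = (r - (1 - g)) * (r - (2 + g)) + (g ^+ 2 + g - 1) by ring.
rewrite g2; nra.
Qed.

End constants.

Section optimum.
Context {R : realType}.
Implicit Types r v t : R.

(** Each regime with the polynomial facts used later, free of [sqrt 5] and of the choice in [vstar].
    The middle [delta] is written in the form that makes [2 - 2r - delta] equal to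
    [2 - r / (1 - v)]. *)
Variant d_DoQF_spec r : R -> R -> R -> Prop :=
| DoQF_low of r <= 1 / 4 : d_DoQF_spec r (2 * (1 - r)) (1 / 2) 0
| DoQF_mid v of 1 / 4 < r & r <= 3 / 8 & 1 / 2 <= v & v ^+ 2 + v <= 1 & r <= 1 - v
    & vstar_cubic r v = 0 :
    d_DoQF_spec r (2 - r / (1 - v)) v (r / (1 - v) - 2 * r)
| DoQF_golden g of 1 / 4 < r & r <= 1 - g & 8 / 13 < g < 5 / 8 & g ^+ 2 = 1 - g
    & vstar_cubic r g <= 0 :
    d_DoQF_spec r (2 - r / (1 - g)) g (r / g)
| DoQF_high of 3 / 8 < r & r ^+ 2 - 3 * r + 1 <= 0 :
    d_DoQF_spec r ((2 - r) * (1 - r)) (1 / (2 - r)) (r / (1 / (2 - r))).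

Lemma d_DoQFP r : 0 <= r <= 1 -> d_DoQF_spec r (d_DoQF r) (t0_DoQF r) (delta_DoQF r).
Proof.
move=> /andP[r0 r1]; have [g [[gE gb g2 hE mE] slope]] := @golden_facts R.
have /andP[gl gu] := gb.
have /andP[ml mu] := @r_mid_bounds R.
rewrite /delta_DoQF /t0_DoQF /d_DoQF.
have [low|low] := lerP r r_low.
  by rewrite /pos_part max_r ?subr_ge0//; exact: DoQF_low.
have [mid|mid] := lerP r r_mid.
  have [/andP[vl vg] v0] : is_vstar r (vstar r) by apply: vstarP; rewrite low mid.
  rewrite gE in vg; rewrite /r_low in low.
  move: (vstar r) vl vg v0 => v vl vg v0.
  have s0 : 0 < 1 - v by lra.
  (* The two sides differ by [- vstar_cubic r v / (v (1 - v))]. *)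
  have -> : 4 * (r / v) + 2 * (r + 1) * v - 2 - 5 * r = r / (1 - v) - 2 * r.
    have vs0 : 0 < v * (1 - v) by rewrite mulr_gt0//; lra.
    apply/eqP; rewrite -subr_eq0 -(mulIr_eq0 _ (mulIf (lt0r_neq0 vs0))); apply/eqP.
    rewrite [LHS](_ : _ = - vstar_cubic r v); first by rewrite /vstar_cubic v0 oppr0.
    by rewrite /vstar_cubic; field; rewrite !gt_eqF//; lra.
  apply: DoQF_mid => //; last lra.
  - lra.
  - nra.
have [high|high] := lerP r r_high.
  rewrite slope gE; apply: DoQF_golden => //; first by rewrite -hE.
  by have [_ ->] := vstar_cubic_golden r g2 gb mE; rewrite ltW.
apply: DoQF_high; last by apply: r_high_gt; rewrite high r1.
by move: high; rewrite hE; lra.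
Qed.

Lemma t0_DoQF_bounds r : 0 <= r -> r < 1 -> [/\ 1 / 2 <= t0_DoQF r, r < t0_DoQF r & t0_DoQF r < 1].
Proof.
move=> r0 r1; have r01 : 0 <= r <= 1 by rewrite r0 ltW.
case: (d_DoQFP r01) => [rl|v rl ru vl vu rv _|g rl rg /andP[gl gu] _ _|rl _].
- by split; lra.
- by split; nra.
- by split; lra.
- have s0 : 0 < 2 - r by lra.
  by rewrite ler_pdivlMr// ltr_pdivlMr// ltr_pdivrMr//; split; nra.
Qed.

End optimum.

(** * Converse for all parameters and attainment at the optimum *)

Section doqf.
Context {R : realType} {d : measure_display} {T : measurableType d}.
Variables (P : probability T R) (G01 G02 G12 : T -> R).
Hypotheses (f01 : fading_gain P G01) (f02 : fading_gain P G02)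
  (f12 : fading_gain P G12) (ind : independent_gains P G01 G02 G12).
Variables (alpha0 alpha1 t0 r delta : R) (rate dist phi : R -> R).
Hypotheses (alpha0_gt0 : 0 < alpha0) (alpha1_gt0 : 0 < alpha1) (t01 : 0 < t0 < 1).
Hypothesis r01 : 0 <= r <= 1.
Hypothesis rate_r : rate rho / ln rho @[rho --> +oo] --> r.
Hypothesis rate_expo : r = 0 -> expo_eq rate 0.
Hypotheses (dist_expo : expo_eq dist delta)
  (phi_expo : expo_eq phi (1 + pos_part (1 - r / t0))).

Local Notation reaches :=
  (outage_reaches P G01 G02 G12 alpha0 alpha1 t0 rate dist phi).
Local Notation is_dmt := (has_dmt P G01 G02 G12 alpha0 alpha1 t0 rate dist phi).

Let no_decode := reaches_no_decode f01 f02 f12 ind alpha0_gt0 alpha1_gt0 t01 r01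
  rate_r dist_expo phi_expo.
Let symmetric := reaches_symmetric f01 f02 f12 ind alpha0_gt0 alpha1_gt0 t01 r01
  rate_r rate_expo dist_expo phi_expo.
Let relay_line := reaches_relay_line f01 f02 f12 ind alpha0_gt0 alpha1_gt0 t01 r01
  rate_r dist_expo phi_expo.
Let direct_line := reaches_direct_line f01 f02 f12 ind alpha0_gt0 alpha1_gt0 t01 r01
  rate_r dist_expo phi_expo.
Let quantize := reaches_quantize f01 f02 f12 ind alpha0_gt0 alpha1_gt0 t01 r01
  rate_r dist_expo phi_expo.

(** Serves both middle regimes: the cubic vanishes at [v*] and is nonpositive at the golden value.
    For [t0 < v] the undecoded regime limits the exponent, for [t0 >= v] the short relaying slot
    does. *)
Let reaches_mid (v : R) : 1 / 4 < r -> 1 / 2 <= v -> v ^+ 2 + v <= 1 -> r <= 1 - v ->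
  vstar_cubic r v <= 0 -> reaches (2 - r / (1 - v)).
Proof.
move=> r4 vl vu rv v0; have [t00 t1] := andP t01.
have v1 : 0 < 1 - v by nra.
have rv1 : r / (1 - v) <= 1 by rewrite ler_pdivrMr// mul1r.
have [tr|rt] := lerP t0 r; first by apply: outage_reaches_le (no_decode tr); lra.
have [vt|tv] := lerP v t0; last first.
  have [c1 c2 c3] := quantize_tradeoff_mid (ltW r4) vl vu v0 t00 tv.
  by apply: quantize => //; lra.
have [rs|sr] := lerP r (1 - t0).
  apply: outage_reaches_le (relay_line rt _ rs); last lra.
  rewrite lerD2l lerN2 ler_pM2l; last lra.
  by rewrite lef_pV2 ?posrE; lra.
apply: outage_reaches_le (direct_line rt (ltW sr)).
have : (1 - r) / t0 <= 1 by rewrite ler_pdivrMr// mul1r; lra.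
lra.
Qed.

Lemma outage_reaches_d_DoQF : reaches (d_DoQF r).
Proof.
have [t00 t1] := andP t01; have [r0 r1] := andP r01.
case: (d_DoQFP r01) => [rl|v rl ru vl vu rv v0|g rl rg /andP[gl gu] g2 g0|rl r2].
- have [tr|rt] := lerP t0 r; last exact: symmetric.
  by apply: outage_reaches_le (no_decode tr); lra.
- by apply: reaches_mid => //; rewrite v0.
- by apply: reaches_mid => //; lra.
have [tr|rt] := lerP t0 r; first by apply: outage_reaches_le (no_decode tr); nra.
(* [t0 = 1 / (2 - r)] is where [(1 - r) / t0] meets [2 - r - r / t0]. *)
have [tt|tt] := ltrP (t0 * (2 - r)) 1.
  have -> : (2 - r) * (1 - r) = 2 - (3 * r - r ^+ 2) by ring.
  apply: quantize => //; [lra| |nra|].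
    have k : r * (2 - r) <= r / t0.
      by rewrite ler_pdivlMr// -mulrA ger_pMr 1?mulrC; lra.
    by move: k; lra.
  by apply: quantize_tradeoff_high => //; rewrite ?r1 ?andbT; lra.
apply: outage_reaches_le (direct_line rt _).
  by rewrite ler_pdivrMr//; nra.
nra.
Qed.

Lemma dmt_le_d_DoQF l : is_dmt l -> (l <= (d_DoQF r)%:E)%E.
Proof. exact: dmt_le_of_reaches outage_reaches_d_DoQF. Qed.

Lemma dmt_at_r1 : r = 1 -> is_dmt (d_DoQF r)%:E.
Proof.
move=> re; have d0 : d_DoQF r = 0.
  case: (d_DoQFP r01) => [|v _ ru _ _ _ _|g _ rg /andP[gl _] _ _|_ _]; rewrite re; lra.
rewrite d0; have := outage_reaches_d_DoQF; rewrite d0.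
by apply: dmt_trivial; eassumption.
Qed.

Lemma dmt_at_optimum : r < 1 -> t0 = t0_DoQF r ->
  (\forall rho \near +oo, code_size t0 rate rho <= dist rho) /\ 2 / 3 < r \/
  delta = delta_DoQF r /\ r <= 2 / 3 ->
  is_dmt (d_DoQF r)%:E.
Proof.
move=> rlt tE; have [t00 t1] := andP t01; have [r0 r1] := andP r01.
have := outage_reaches_d_DoQF; have := t0_DoQF_bounds r0 rlt; rewrite -tE.
have simple := dmt_simple f01 f02 f12 ind alpha0_gt0 alpha1_gt0 t01
  rate_r dist_expo phi_expo.
have balanced := dmt_balanced f01 f02 f12 ind alpha0_gt0 alpha1_gt0 t01 r01
  rate_r dist_expo phi_expo.
move: tE; case: (d_DoQFP r01) =>
  [rl|v rl ru vl vu rv v0|g rl rg /andP[gl gu] g2 g0|rl r2] tE [th rt _] hc.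
(* The three costs are [2 - 2r], [2 - 2r] and [4 - 10 r]; the last is large enough exactly for
   [r <= 1/4]. *)
- case=> [[_ ?]|[dE _]]; first lra.
  have e2 : r / (1 / 2) = 2 * r by field.
  have e1 : 1 - 1 / 2 = 1 / 2 :> R by field.
  by apply: (balanced _ hc) => //; rewrite ?dE ?tE ?e1 ?mul0r ?subr0 ?e2; lra.
- case=> [[_ ?]|[dE _]]; first lra.
  rewrite -tE in dE v0 vl vu rv hc *.
  have s0 : 0 < 1 - t0 by lra.
  apply: (balanced _ hc) => //; rewrite ?dE.
  + by rewrite subr_ge0 ler_pdivlMr//; nra.
  + lra.
  (* The third cost exceeds the claim by [vstar_cubic r t0 / (t0 (1 - t0)^2)], that is by 0. *)
  + have ts : 0 < t0 * (1 - t0) ^+ 2 by rewrite mulr_gt0// exprn_gt0.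
    rewrite -subr_ge0 -(pmulr_lge0 _ ts).
    rewrite [leRHS](_ : _ = vstar_cubic r t0); first by rewrite v0.
    by rewrite /vstar_cubic; field; rewrite !gt_eqF.
- case=> [[_ ?]|[dE r23]]; first lra.
  rewrite -tE in dE gl gu g2 rg hc *.
  (* At the golden ratio the costs [2 - r / t1] and [2 - r - r / t0] coincide. *)
  have i1 : r / (1 - t0) = r + r / t0.
    by rewrite -g2; apply: (mulIf (lt0r_neq0 (exprn_gt0 2 t00))); field: g2; rewrite gt_eqF.
  apply: (simple _ hc) => //; [by left|by rewrite i1; lra|right; split => //].
  rewrite i1; have : r / t0 <= r * (13 / 8).
    by rewrite ler_pdivrMr// -mulrA ler_peMr//; lra.
  lra.
- have s0 : 0 < 2 - r by lra.
  have kE : r / t0 = r * (2 - r) by rewrite tE div1r invrK.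
  have lE : (1 - r) / t0 = (2 - r) * (1 - r) by rewrite tE div1r invrK mulrC.
  move=> h; apply: (simple _ hc) => //.
  + by right; rewrite lE.
  + by rewrite kE; lra.
  case: h => [[Kd _]|[dE r23]]; [by left|right; split].
    by rewrite dE tE.
  (* After division by [1 - r] the claim is [2 - r <= 4 (1 - r)], i.e. [r <= 2/3]. *)
  by rewrite kE; nra.
Qed.

End doqf.

Theorem theorem3
  (R : realType) (disp : measure_display) (T : measurableType disp)
  (P : probability T R)
  (H01 H02 H12 : {RV P >-> (R * R)%type}) (s01 s02 s12 : R)
  (alpha0 alpha1 r : R) (rate : R -> R) (dist phi : R -> R -> R -> R)
  (s01_gt0 : 0 < s01) (s02_gt0 : 0 < s02) (s12_gt0 : 0 < s12)
  (H01_CN : CN s01 H01) (H02_CN : CN s02 H02) (H12_CN : CN s12 H12)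
  (H_indep : independent3 H01 H02 H12)
  (alpha0_gt0 : 0 < alpha0) (alpha1_gt0 : 0 < alpha1)
  (r01 : 0 <= r <= 1)
  (rate_r : rate rho / ln rho @[rho --> +oo] --> r)
  (* for r > 0 this follows from rate_r *)
  (rate_expo : r = 0 -> expo_eq rate 0)
  (dist_expo : forall t0 delta : R, 0 < t0 < 1 ->
     expo_eq (dist t0 delta) delta)
  (phi_expo : forall t0 delta : R, 0 < t0 < 1 ->
     expo_eq (phi t0 delta) (1 + pos_part (1 - r / t0))) :
  let is_d (t0 delta : R) (l : \bar R) : Prop :=
    has_dmt P (gain H01) (gain H02) (gain H12) alpha0 alpha1 t0
      rate (dist t0 delta) (phi t0 delta) l in
  [/\ r_low < r <= r_mid -> exists! v : R, is_vstar r v,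
      ereal_sup [set l : \bar R | exists t0 delta : R,
                   0 < t0 < 1 /\ is_d t0 delta l] = (d_DoQF r)%:E,
      r < 1 ->
        0 < t0_DoQF r < 1 /\
        ereal_sup [set l : \bar R | exists delta : R,
                     is_d (t0_DoQF r) delta l] = (d_DoQF r)%:E,
      r < 1 ->
      (* for r > 2/3, the tie delta = r / t0 is resolved by K <= Delta^2 *)
      (2 / 3 < r -> \forall rho \near +oo,
         code_size (t0_DoQF r) rate rho
         <= dist (t0_DoQF r) (delta_DoQF r) rho) ->
        is_d (t0_DoQF r) (delta_DoQF r) (d_DoQF r)%:E &
      r = 1 ->
        t0_DoQF r = 1 /\ delta_DoQF r = 1 /\
        \forall t0 \near 1^'-, is_d t0 (r / t0) (d_DoQF r)%:E].
Proof.
move=> is_d.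
have f01 := CN_fading_gain s01_gt0 H01_CN.
have f02 := CN_fading_gain s02_gt0 H02_CN.
have f12 := CN_fading_gain s12_gt0 H12_CN.
have ind := independent3_gains H_indep.
have [r0 r1] := andP r01.
have is_d_le t0 delta l : 0 < t0 < 1 -> is_d t0 delta l -> (l <= (d_DoQF r)%:E)%E.
  move=> t01; exact: (dmt_le_d_DoQF f01 f02 f12 ind alpha0_gt0 alpha1_gt0 t01 r01
    rate_r rate_expo (dist_expo _ _ t01) (phi_expo _ _ t01)).
have at1 t0 delta : r = 1 -> 0 < t0 < 1 -> is_d t0 delta (d_DoQF r)%:E.
  move=> re t01; exact: (dmt_at_r1 f01 f02 f12 ind alpha0_gt0 alpha1_gt0 t01 r01
    rate_r rate_expo (dist_expo _ _ t01) (phi_expo _ _ t01) re).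
have opt01 : r < 1 -> 0 < t0_DoQF r < 1.
  by move=> /(t0_DoQF_bounds r0)[h1 _ ->]; rewrite andbT; lra.
have at_opt delta (rlt : r < 1) := dmt_at_optimum f01 f02 f12 ind alpha0_gt0
  alpha1_gt0 (opt01 rlt) r01 rate_r rate_expo (dist_expo _ delta (opt01 rlt))
  (phi_expo _ delta (opt01 rlt)) rlt erefl.
have ex_opt : r < 1 -> exists delta, is_d (t0_DoQF r) delta (d_DoQF r)%:E.
  move=> rlt; have [r23|r23] := lerP r (2 / 3).
    by exists (delta_DoQF r); apply: (at_opt _ rlt); right.
  (* Any [delta] strictly above the tie makes [K <= Delta^2] eventually true. *)
  exists (r / t0_DoQF r + 1); apply: (at_opt _ rlt); left; split => //.
  apply: (near_code_size_le (opt01 rlt) rate_r (dist_expo _ _ (opt01 rlt))).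
  by rewrite ltrDl.
split.
- exact: ex_unique_vstar.
- apply/eqP; rewrite eq_le; apply/andP; split.
    by apply: ge_ereal_sup => l [t0 [delta [t01 /(is_d_le _ _ _ t01)]]].
  apply: ereal_sup_ubound; have [rlt|rge] := ltrP r 1.
    have [delta h] := ex_opt rlt; exists (t0_DoQF r), delta; split => //.
    exact: opt01.
  (* At [r = 1] every pair attains the exponent 0; this one is arbitrary. *)
  have t01 : 0 < (1 / 2 : R) < 1 by apply/andP; split; lra.
  exists (1 / 2), 0; split => //; apply: at1 => //.
  by apply/eqP; rewrite eq_le r1.
- move=> rlt; split; first exact: opt01.
  apply/eqP; rewrite eq_le; apply/andP; split.
    by apply: ge_ereal_sup => l [delta /(is_d_le _ _ _ (opt01 rlt))].
  by apply: ereal_sup_ubound; have [delta h] := ex_opt rlt; exists delta.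
- move=> rlt Kd; apply: (at_opt _ rlt); have [r23|r23] := lerP r (2 / 3); [right|left] => //.
  by split => //; exact: Kd.
- move=> re; have e1 : 2 - r = 1 by rewrite re; ring.
  have [-> ->] : t0_DoQF r = 1 /\ delta_DoQF r = 1.
    case: (d_DoQFP r01) => [rl|v _ ru _ _ _ _|g _ rg /andP[gl _] _ _|_ _].
    - lra.
    - lra.
    - lra.
    - by rewrite e1 re !divr1.
  split => //; split => //.
  near=> t0; apply: at1 => //; apply/andP; split.
    by near: t0; exact: nbhs_left_gt.
  by near: t0; exact: nbhs_left_lt.
Unshelve. all: by end_near. Qed.
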